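(* Let $d_1,d_2 \geq 2$ be integers and let $G_1 \leq \operatorname{SL}_{d_1}(\mathbb{Z})$ and $G_2 \leq \operatorname{SL}_{d_2}(\mathbb{Z})$ be subgroups, each generated by finitely many unipotent elements, such that $G_1 \curvearrowright \mathbb{R}^{d_1}$ and $G_2 \curvearrowright \mathbb{R}^{d_2}$ are irreducible representations. Then for all $\epsilon>0$ there exists $k \in \mathbb{N}$ such that if $Y \subset \mathbb{T}^{d_1} \times \mathbb{T}^{d_2}$ satisfies $|Y| \geq k$ and the projections $Y\to\mathbb{T}^{d_1}$ and $Y\to\mathbb{T}^{d_2}$ are both injective on $Y$, then there exists $g \in G_1 \times G_2$ such that $gY$ is $\epsilon$-dense in $\mathbb{T}^{d_1} \times \mathbb{T}^{d_2}$.
   Context: $\mathbb{T}^d=\mathbb{R}^d/\mathbb{Z}^d$, on which $\operatorname{SL}_d(\mathbb{Z})$ acts by matrix multiplication. $G_1\times G_2$ acts on $\mathbb{T}^{d_1}\times\mathbb{T}^{d_2}=\mathbb{T}^{d_1+d_2}$ by the product action $(g_1,g_2)\cdot(x_1,x_2)=(g_1x_1,g_2x_2)$. For $u\in\mathbb{T}^d$, $|u|$ denotes the $\|\cdot\|_\infty$-distance from the origin of $\mathbb{R}^d$ to the closest point of the preimage of $u$ in $\mathbb{R}^d$. A subset $Z\subset\mathbb{T}^d$ is $\epsilon$-dense if for every $\alpha\in\mathbb{T}^d$ there is $z\in Z$ with $|\alpha-z|\le\epsilon$. *)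

(* Defs.v *)
From HB Require Import structures.
From mathcomp Require Import all_boot all_order all_algebra.
From mathcomp Require Import all_classical all_reals all_analysis.

Set Implicit Arguments.
Unset Strict Implicit.
Unset Printing Implicit Defensive.

Import Order.TTheory GRing.Theory Num.Theory.
Import numFieldNormedType.Exports.
Local Open Scope classical_set_scope.
Local Open Scope ring_scope.
Local Open Scope quotient_scope.

Definition SLZ (d : nat) : set 'M[int]_d := [set g | \det g = 1].
Arguments SLZ d : clear implicits.

Definition is_SLZ_subgroup (d : nat) (G : set 'M[int]_d) : Prop :=
  [/\ G `<=` SLZ d,
      G 1%:M,
      (forall g h, G g -> G h -> G (g *m h))
    & (forall g, G g -> G (invmx g))].

(* If S is not contained in SL_d(Z), the intersection is over the empty family
   and yields setT. *)
Definition SLZ_generated (d : nat) (S : set 'M[int]_d) : set 'M[int]_d :=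
  smallest (@is_SLZ_subgroup d) S.

Definition unipotent (d : nat) (g : 'M[int]_d) : Prop :=
  exists n : nat, (g - 1%:M) ^+ n = 0.

Definition unipotently_generated (d : nat) (G : set 'M[int]_d) : Prop :=
  exists2 s : seq 'M[int]_d,
    (forall g, g \in s -> unipotent g) & G = SLZ_generated [set` s].

Definition irreducible_action (R : realType) (d : nat) (G : set 'M[int]_d) :
    Prop :=
  (fullv != 0 :> {vspace 'cV[R]_d})%VS /\
  forall U : {vspace 'cV[R]_d},
    (forall g, G g -> forall v, v \in U -> map_mx intr g *m v \in U) ->
    U = 0%VS \/ U = fullv.

Definition integer_vector (R : realType) (d : nat) : {pred 'cV[R]_d} :=
  fun x => [forall i, x i 0 \is a Num.int].
Arguments integer_vector R d : clear implicits.

Fact integer_vector_zmod_closed (R : realType) (d : nat) :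
  zmod_closed (integer_vector R d).
Proof.
split=> [|x y /forallP xZ /forallP yZ]; apply/forallP => i; rewrite !mxE.
  exact: rpred0.
exact: rpredB.
Qed.

HB.instance Definition _ (R : realType) (d : nat) :=
  GRing.isZmodClosed.Build 'cV[R]_d (integer_vector R d)
    (integer_vector_zmod_closed R d).

Definition torus (R : realType) (d : nat) :=
  Quotient.quot (integer_vector R d).

Definition torus_proj (R : realType) (d : nat) (x : 'cV[R]_d) : torus R d :=
  \pi x.

Definition torus_repr (R : realType) (d : nat) (u : torus R d) : 'cV[R]_d :=
  repr u.

(* Independent of the choice of representative: see torus_actE. *)
Definition torus_act (R : realType) (d : nat) (g : 'M[int]_d) (u : torus R d) :
    torus R d :=
  torus_proj (map_mx intr g *m torus_repr u).

Definition prod_act (R : realType) (d1 d2 : nat)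
    (g : 'M[int]_d1 * 'M[int]_d2) (u : torus R d1 * torus R d2) :
    torus R d1 * torus R d2 :=
  (torus_act g.1 u.1, torus_act g.2 u.2).

(* The identification of T^d1 x T^d2 with T^(d1 + d2); see torus_joinE. *)
Definition torus_join (R : realType) (d1 d2 : nat)
    (u : torus R d1 * torus R d2) : torus R (d1 + d2) :=
  torus_proj (col_mx (torus_repr u.1) (torus_repr u.2)).

(* The norm of a column vector is its sup norm mx_norm.  The set is nonempty
   and bounded below by 0, so inf is its greatest lower bound. *)
Definition torus_norm (R : realType) (d : nat) (u : torus R d) : R :=
  inf [set `|x| | x in [set x : 'cV[R]_d | torus_proj x = u]].

Definition eps_dense (R : realType) (d : nat) (eps : R)
    (Z : set (torus R d)) : Prop :=
  forall a : torus R d, exists2 z, Z z & torus_norm (a - z) <= eps.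

Section Wellformedness.
Variable R : realType.

Lemma torus_projK d (u : torus R d) : torus_proj (torus_repr u) = u.
Proof. exact: reprK. Qed.

Lemma torus_proj_eqP d (x y : 'cV[R]_d) :
  torus_proj x = torus_proj y <-> forall i, (x - y) i 0 \is a Num.int.
Proof.
split=> [/eqP|xy].
  by rewrite -Quotient.idealrBE => /forallP.
by apply/eqP; rewrite -Quotient.idealrBE; apply/forallP.
Qed.

Lemma torus_projB d (x y : 'cV[R]_d) :
  torus_proj (x - y) = torus_proj x - torus_proj y.
Proof. by rewrite /torus_proj raddfB. Qed.

Lemma torus_actE d (g : 'M[int]_d) (x : 'cV[R]_d) :
  torus_act g (torus_proj x) = torus_proj (map_mx intr g *m x).
Proof.
apply/torus_proj_eqP => i; rewrite -mulmxBr mxE rpred_sum// => j _.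
rewrite mxE rpredM ?intr_int//.
by move: j; apply/torus_proj_eqP; rewrite torus_projK.
Qed.

Lemma torus_joinE d1 d2 (x : 'cV[R]_d1) (y : 'cV[R]_d2) :
  torus_join (torus_proj x, torus_proj y) = torus_proj (col_mx x y).
Proof.
apply/torus_proj_eqP => i; rewrite opp_col_mx add_col_mx /=.
case: (split_ordP i) => j ->; rewrite ?col_mxEu ?col_mxEd;
  by move: j; apply/torus_proj_eqP; rewrite torus_projK.
Qed.

Lemma torus_join_bij d1 d2 : bijective (@torus_join R d1 d2).
Proof.
exists (fun u => (torus_proj (usubmx (torus_repr u)),
                  torus_proj (dsubmx (torus_repr u)))).
- move=> [u v]; set w := torus_join _.
  have /torus_proj_eqP uvw : torus_proj (torus_repr w) =
      torus_proj (col_mx (torus_repr u) (torus_repr v)) by rewrite torus_projK.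
  congr pair; rewrite -[RHS]torus_projK; apply/torus_proj_eqP => i.
  + by have := uvw (lshift d2 i); rewrite mxE [in X in X -> _]mxE col_mxEu !mxE.
  + by have := uvw (rshift d1 i); rewrite mxE [in X in X -> _]mxE col_mxEd !mxE.
- by move=> u; rewrite torus_joinE vsubmxK torus_projK.
Qed.

End Wellformedness.

(* Main.v *)
Require Import Defs.
From HB Require Import structures.
From mathcomp Require Import all_boot all_order all_algebra.
From mathcomp Require Import all_classical all_reals all_analysis.
From mathcomp Require Import complex ring lra zify.

Set Implicit Arguments.
Unset Strict Implicit.
Unset Printing Implicit Defensive.

Import Order.TTheory GRing.Theory Num.Theory.
Import numFieldNormedType.Exports.
Local Open Scope classical_set_scope.
Local Open Scope card_scope.
Local Open Scope ring_scope.

(** The proof is by second moments. Let [y_1], ..., [y_k] be points of [Y]. By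
    [density_criterion], a translate [g Y] is [eps]-dense as soon as, for each
    of finitely many nonzero integer characters [m] of the product torus, the
    exponential sum of [m (g y_i)] over [i] is at most [eta k] in modulus. So
    it is enough to find a mean over [g] for which the squares of these moduli
    have mean less than [(eta k) ^ 2]; a single [g] then serves all the
    characters.

    Expanding the square gives a sum over pairs [(i, j)] of the mean of the
    cosine of [m (g (y_i - y_j))]. The heart of the matter is
    [character_decay]: for a nonzero character this mean is at most [delta]
    unless the difference is a torsion point of order dividing some [Q] that
    does not depend on the points. Since both projections are injective on
    [Y], each [i] has at most [Q ^ d] exceptional partners [j]
    ([card_torsion_le]), and the second moment is at most
    [k (Q ^ d + k delta)], which is small against [k ^ 2] for large [k].

    The mean over [g] runs over products [u_1 ^ n_1 ... u_r ^ n_r] of powers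
    of the unipotent generators, taken in order and repeated many times, and
    is an iterated Banach mean in the exponents: a positive, normalized,
    shift-invariant functional on bounded sequences, which spares the error
    terms of finite averages. For unipotent [u] the phase [m (u ^ n x)] is a
    polynomial in [n], and [weyl] says that its exponential has small mean
    unless the nonconstant coefficients are rational with bounded denominator.
    As some generator moves [m], a mean that is not small makes a nonzero
    character integral at [g x] for a set of words [g] of positive mean;
    [integral_word] upgrades this to all words, up to a bounded multiple, and
    by irreducibility ([integral_orbit_torsion]) the point [x] is then torsion
    of bounded order. *)

(** * Means of bounded functions *)

Definition bounded_real (R : realType) (T : Type) (f : T -> R) : Prop :=
  exists C : R, forall t, `|f t| <= C.

Section BoundedFunctions.
Context {R : realType} {T : Type}.
Implicit Types f g : T -> R.

Lemma bounded_real_cst (c : R) : bounded_real (fun _ : T => c).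
Proof. by exists `|c|. Qed.

Lemma bounded_realD f g :
  bounded_real f -> bounded_real g -> bounded_real (fun t => f t + g t).
Proof.
move=> [C fC] [D gD]; exists (C + D) => t.
by rewrite (le_trans (ler_normD _ _))// lerD.
Qed.

Lemma bounded_realM f g :
  bounded_real f -> bounded_real g -> bounded_real (fun t => f t * g t).
Proof.
move=> [C fC] [D gD]; exists (C * D) => t.
by rewrite normrM ler_pM.
Qed.

Lemma bounded_realZ (c : R) f : bounded_real f -> bounded_real (fun t => c * f t).
Proof. by apply: bounded_realM; exact: bounded_real_cst. Qed.

Lemma bounded_real_sum (I : Type) (r : seq I) (P : pred I) (f : I -> T -> R) :
  (forall i, bounded_real (f i)) ->
  bounded_real (fun t => \sum_(i <- r | P i) f i t).
Proof.
move=> fb; elim: r => [|i r IH].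
  by exists 0 => t; rewrite big_nil normr0.
have [Pi|Pi] := boolP (P i).
  have [C HC] := bounded_realD (fb i) IH.
  by exists C => t; rewrite big_cons Pi.
by have [C HC] := IH; exists C => t; rewrite big_cons (negbTE Pi).
Qed.

Lemma bounded_real_comp (S : Type) (h : S -> T) f :
  bounded_real f -> bounded_real (fun s => f (h s)).
Proof. by move=> [C fC]; exists C. Qed.

Lemma bounded_real_bool (b : T -> bool) : bounded_real (fun t => (b t)%:R : R).
Proof. by exists 1 => t; case: (b t); rewrite ?normr1 ?normr0. Qed.

End BoundedFunctions.

(** The linear laws are only required on bounded functions, because limits
    along an ultrafilter are only well behaved there. *)
Definition is_mean (R : realType) (T : Type) (E : (T -> R) -> R) : Prop :=
  [/\ forall c, E (fun=> c) = c,
      forall c f, bounded_real f -> E (fun t => c * f t) = c * E f,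
      forall f g, bounded_real f -> bounded_real g ->
        E (fun t => f t + g t) = E f + E g
    & forall f g, bounded_real f -> bounded_real g ->
        (forall t, f t <= g t) -> E f <= E g].

Section MeanTheory.
Context {R : realType} {T : Type} {E : (T -> R) -> R}.
Hypothesis mE : is_mean E.

Lemma mean_cst c : E (fun=> c) = c. Proof. by case: mE. Qed.

Lemma meanZ c f : bounded_real f -> E (fun t => c * f t) = c * E f.
Proof. by case: mE => _ + _ _; exact. Qed.

Lemma meanD f g : bounded_real f -> bounded_real g ->
  E (fun t => f t + g t) = E f + E g.
Proof. by case: mE => _ _ + _; exact. Qed.

Lemma mean_le f g : bounded_real f -> bounded_real g ->
  (forall t, f t <= g t) -> E f <= E g.
Proof. by case: mE => _ _ _; exact. Qed.

Lemma mean_sum (I : Type) (r : seq I) (P : pred I) (f : I -> T -> R) :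
  (forall i, bounded_real (f i)) ->
  E (fun t => \sum_(i <- r | P i) f i t) = \sum_(i <- r | P i) E (f i).
Proof.
move=> fb; elim: r => [|i r IH].
  rewrite big_nil -[RHS](mean_cst 0); congr E.
  by apply/funext => t; rewrite big_nil.
rewrite big_cons; case: ifPn => Pi.
  rewrite -IH -meanD//; last exact: bounded_real_sum.
  by congr E; apply/funext => t; rewrite big_cons Pi.
by rewrite -IH; congr E; apply/funext => t; rewrite big_cons (negbTE Pi).
Qed.

Lemma mean_norm_le f C : (forall t, `|f t| <= C) -> `|E f| <= C.
Proof.
move=> fC; have fb : bounded_real f by exists C.
rewrite ler_norml -{1}[- C]mean_cst -{2}[C]mean_cst.
by apply/andP; split; apply: mean_le => //; try exact: bounded_real_cst;
  move=> t; have := fC t; rewrite ler_norml => /andP[].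
Qed.

Lemma mean_lt_ex f c : bounded_real f -> E f < c -> exists t, f t < c.
Proof.
move=> fb; apply: contraPP => nf; apply/negP; rewrite -leNgt.
rewrite -[c]mean_cst; apply: mean_le => //; first exact: bounded_real_cst.
by move=> t; rewrite leNgt; apply/negP => ft; apply: nf; exists t.
Qed.

Lemma mean_gt_ex f c : bounded_real f -> c < E f -> exists t, c < f t.
Proof.
move=> fb; apply: contraPP => nf; apply/negP; rewrite -leNgt.
rewrite -[c]mean_cst; apply: mean_le => //; first exact: bounded_real_cst.
by move=> t; rewrite leNgt; apply/negP => ft; apply: nf; exists t.
Qed.

End MeanTheory.

Lemma bounded_real_mean (R : realType) (S T : Type) (E : (T -> R) -> R)
    (f : S -> T -> R) (C : R) : is_mean E ->
  (forall s t, `|f s t| <= C) -> bounded_real (fun s => E (f s)).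
Proof. by move=> mE fC; exists C => s; apply: (mean_norm_le mE). Qed.

Lemma is_mean_dirac (R : realType) (T : Type) (t : T) :
  is_mean (fun f : T -> R => f t).
Proof. by split. Qed.

(** Iterated means. No interchange of the two means is available, so the order
    in which variables are averaged matters below. *)
Lemma is_mean_bind (R : realType) (S T V : Type) (E : (S -> R) -> R)
    (F : (T -> R) -> R) (h : S -> T -> V) : is_mean E -> is_mean F ->
  is_mean (fun f : V -> R => E (fun s => F (fun t => f (h s t)))).
Proof.
move=> mE mF.
have bF f : bounded_real f -> bounded_real (fun s => F (fun t => f (h s t))).
  by move=> [C fC]; exact: (bounded_real_mean mF).
have bf f s : bounded_real f -> bounded_real (fun t => f (h s t)).
  by move=> [C fC]; exists C.
split=> [c|c f fb|f g fb gb|f g fb gb fg].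
- rewrite (_ : (fun s => _) = fun=> c) ?(mean_cst mE)//.
  by apply/funext => s; rewrite (mean_cst mF).
- rewrite -(meanZ mE)//; last exact: bF.
  by congr E; apply/funext => s; rewrite -(meanZ mF)//; exact: bf.
- rewrite -(meanD mE); [|exact: bF|exact: bF].
  by congr E; apply/funext => s; rewrite -(meanD mF)//; exact: bf.
- apply: (mean_le mE); [exact: bF|exact: bF|move=> s].
  by apply: (mean_le mF) => [||t]; [exact: bf|exact: bf|exact: fg].
Qed.

Lemma fmap_ultra (S T : Type) (f : S -> T) (U : set_system S) :
  UltraFilter U -> UltraFilter (f @ U).
Proof.
move=> UU; split; first exact: fmap_proper_filter.
move=> G GF UG; rewrite predeqE => A; split; last exact: UG.
move=> GA; have [//|UA] := in_ultra_setVsetC (f @^-1` A) UU.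
have GnA : G (~` A) by apply: UG.
have GI : G (A `&` ~` A) by apply: filterI.
by have [x []] := filter_ex GI.
Qed.

Lemma ultra_bounded_cvg (R : realType) (S : Type) (U : set_system S)
    (f : S -> R) : UltraFilter U -> bounded_real f -> cvg (f @ U).
Proof.
move=> UU [C fC]; have := @segment_compact R (- C) C.
rewrite compact_ultra => /(_ (f @ U) (fmap_ultra f UU)).
have UC : (f @ U) `[- C, C]%classic.
  apply: (@filterS _ U _ setT); last exact: filterT.
  by move=> s _ /=; rewrite in_itv /= -ler_norml.
by move=> /(_ UC)[l [_ fl]]; apply/cvg_ex; exists l.
Qed.

Definition cesaro (R : realType) (f : nat -> R) (N : nat) : R :=
  (\sum_(n < N.+1) f n) / N.+1%:R.

Lemma cesaro_norm_le (R : realType) (f : nat -> R) (C : R) :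
  (forall n, `|f n| <= C) -> forall N, `|cesaro f N| <= C.
Proof.
move=> fC N; rewrite /cesaro normrM normfV ler_pdivrMr ?normr_gt0 ?pnatr_eq0//.
rewrite (le_trans (ler_norm_sum _ _ _))// normr_nat mulr_natr.
rewrite -[leRHS](_ : \sum_(i < N.+1) C = _); last by rewrite sumr_const card_ord.
by apply: ler_sum => i _; exact: fC.
Qed.

Lemma invSn_cvg0 (R : realType) : (fun N : nat => N.+1%:R^-1 : R) @ \oo --> (0 : R).
Proof. exact: cvg_harmonic. Qed.

(** Limits along an ultrafilter turn Cesaro averages, which need not
    converge, into an honest linear functional. The average of [f n.+1]
    differs from that of [f n] by the two boundary terms only, which vanish
    in the limit: this is where shift invariance comes from. *)
Lemma banach_mean_exists (R : realType) : exists M : (nat -> R) -> R,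
  is_mean M /\ forall f, bounded_real f -> M (fun n => f n.+1) = M f.
Proof.
have [U [UU Uoo]] := @ultraFilterLemma nat \oo _.
have cesaro_cvg f : bounded_real f -> cvg (@cesaro R f @ U).
  by move=> [C fC]; apply: ultra_bounded_cvg; exists C; exact: cesaro_norm_le.
exists (fun f => lim (cesaro f @ U)); split; first split.
- move=> c; apply: cvg_lim => //; rewrite (_ : cesaro _ = fun=> c).
    exact: cvg_cst.
  apply/funext => N; rewrite /cesaro sumr_const card_ord -[c *+ _]mulr_natr mulfK//.
- move=> c f fb; apply: cvg_lim => //.
  rewrite (_ : cesaro _ = fun N => c * cesaro f N); last first.
    by apply/funext => N; rewrite /cesaro -mulr_sumr mulrA.
  by apply: cvgMr; exact: cesaro_cvg.
- move=> f g fb gb; apply: cvg_lim => //.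
  rewrite (_ : cesaro _ = fun N => cesaro f N + cesaro g N); last first.
    by apply/funext => N; rewrite /cesaro big_split /= mulrDl.
  by apply: cvgD; exact: cesaro_cvg.
- move=> f g fb gb fg; apply: ler_lim; [exact: cesaro_cvg|exact: cesaro_cvg|].
  apply: (@filterS _ U _ setT); last exact: filterT.
  move=> N _; rewrite /cesaro ler_pM2r ?invr_gt0 ?ltr0n//.
  by apply: ler_sum => i _; exact: fg.
- move=> f [C fC]; apply: cvg_lim => //.
  rewrite (_ : cesaro _ = fun N => cesaro f N + (f N.+1 - f 0) * N.+1%:R^-1).
    rewrite -[X in _ --> X]addr0; apply: cvgD.
      by apply: cesaro_cvg; exists C.
    have h0 : (fun N : nat => N.+1%:R^-1 : R) @ U --> (0 : R).
      by apply: cvg_trans (@invSn_cvg0 R); apply: cvg_app.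
    apply/norm_cvg0P.
    apply: (@squeeze_cvgr _ _ _ _ (fun=> 0) (fun N => (C + C) * N.+1%:R^-1)).
    + apply: (@filterS _ U _ setT); last exact: filterT.
      move=> N _; rewrite normr_ge0 /= normrM normfV normr_nat.
      rewrite ler_pM2r ?invr_gt0 ?ltr0n// (le_trans (ler_normB _ _))//.
      by rewrite lerD.
    + exact: cvg_cst.
    + by rewrite -[X in _ --> X](mulr0 (C + C)); apply: cvgMr.
  apply/funext => N; rewrite /cesaro -mulrDl; congr (_ / _).
  by rewrite big_ord_recr [in RHS]big_ord_recl /=; ring.
Qed.

(** * Trigonometric functions of period one *)

Definition cosp (R : realType) (t : R) : R := cos (2 * pi * t).
Definition sinp (R : realType) (t : R) : R := sin (2 * pi * t).

Section PeriodOne.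
Context {R : realType}.
Implicit Types s t : R.

Lemma cospD s t : cosp (s + t) = cosp s * cosp t - sinp s * sinp t.
Proof. by rewrite /cosp mulrDr cosD. Qed.

Lemma sinpD s t : sinp (s + t) = sinp s * cosp t + cosp s * sinp t.
Proof. by rewrite /sinp mulrDr sinD. Qed.

Lemma cospN t : cosp (- t) = cosp t.
Proof. by rewrite /cosp mulrN cosN. Qed.

Lemma sinpN t : sinp (- t) = - sinp t.
Proof. by rewrite /sinp mulrN sinN. Qed.

Lemma cospB s t : cosp (s - t) = cosp s * cosp t + sinp s * sinp t.
Proof. by rewrite cospD cospN sinpN mulrN opprK. Qed.

Lemma cosp2Dsinp2 t : cosp t ^+ 2 + sinp t ^+ 2 = 1.
Proof. exact: cos2Dsin2. Qed.

Lemma cosp_max t : `|cosp t| <= 1. Proof. exact: cos_max. Qed.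
Lemma sinp_max t : `|sinp t| <= 1. Proof. exact: sin_max. Qed.

Lemma bounded_cosp (T : Type) (f : T -> R) : bounded_real (fun x => cosp (f x)).
Proof. by exists 1 => x; exact: cosp_max. Qed.

Lemma bounded_sinp (T : Type) (f : T -> R) : bounded_real (fun x => sinp (f x)).
Proof. by exists 1 => x; exact: sinp_max. Qed.

Lemma cosp_sinp_nat (n : nat) : cosp n%:R = 1 :> R /\ sinp n%:R = 0 :> R.
Proof.
elim: n => [|n [c s]]; first by rewrite /cosp /sinp mulr0 cos0 sin0.
have -> : n.+1%:R = n%:R + 1 :> R by rewrite natr1.
rewrite cospD sinpD c s /cosp /sinp (_ : 2 * pi * 1 = pi + pi); last by ring.
rewrite cosD sinD.
by rewrite cospi sinpi; split; ring.
Qed.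

Lemma cosp_sinp_int t : t \is a Num.int -> cosp t = 1 /\ sinp t = 0.
Proof.
move=> /intrP[[n|n] ->]; first exact: cosp_sinp_nat.
rewrite NegzE mulrNz cospN sinpN.
by have [-> ->] := cosp_sinp_nat n.+1; rewrite oppr0.
Qed.

Lemma cosp_int t : t \is a Num.int -> cosp t = 1.
Proof. by move=> /cosp_sinp_int[]. Qed.

Lemma sinp_int t : t \is a Num.int -> sinp t = 0.
Proof. by move=> /cosp_sinp_int[]. Qed.

Lemma cospDint s t : t \is a Num.int -> cosp (s + t) = cosp s.
Proof. by move=> tZ; rewrite cospD (cosp_int tZ) (sinp_int tZ) mulr1 mulr0 subr0. Qed.

Lemma sinpDint s t : t \is a Num.int -> sinp (s + t) = sinp s.
Proof. by move=> tZ; rewrite sinpD (cosp_int tZ) (sinp_int tZ) mulr1 mulr0 addr0. Qed.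

Lemma cosp1_int t : cosp t = 1 -> t \is a Num.int.
Proof.
move=> ct; set r := t - (Num.floor t)%:~R.
have rt : t = r + (Num.floor t)%:~R by rewrite /r addrNK.
have /andP[r0 r1] : 0 <= r < 1.
  by have /andP[] := floor_itv t; rewrite /r intrD; lra.
suff r00 : r = 0 by rewrite rt r00 add0r intr_int.
have [//|rn0] := eqVneq r 0.
have : cosp r = 1 by rewrite -ct rt cospDint ?intr_int// rt addrK.
have -> : cosp r = cos ((pi * r) *+ 2) by rewrite /cosp mulr2n; congr cos; ring.
rewrite cos_mulr2n cos2sin2 => /eqP h.
have : 0 < sin (pi * r).
  apply: sin_gt0_pi; rewrite mulr_gt0 ?pi_gt0 ?lt0r ?rn0//=.
  by rewrite gtr_pMr ?pi_gt0.
move: h; rewrite mulr2n => /eqP h.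
nra.
Qed.

End PeriodOne.

(** * Exponential sums and correlations *)

Lemma exp_sum_sq (R : realType) (I : Type) (r : seq I) (phi : I -> R) :
  (\sum_(i <- r) cosp (phi i)) ^+ 2 + (\sum_(i <- r) sinp (phi i)) ^+ 2 =
  \sum_(i <- r) \sum_(j <- r) cosp (phi i - phi j).
Proof.
rewrite !expr2 !mulr_suml -big_split /=; apply: eq_bigr => i _.
by rewrite !mulr_sumr -big_split /=; apply: eq_bigr => j _; rewrite cospB.
Qed.

(** If a mean of [F] is at least [delta] while [F] is dominated by the
    modulus of an average of [H] phases, then by Cauchy-Schwarz two of the
    phases are correlated: the [H] diagonal terms of the expanded square
    contribute only [1 / H]. *)
Lemma phase_correlation (R : realType) (T : Type) (E : (T -> R) -> R)
    (H : nat) (phi : nat -> T -> R) (F : T -> R) (delta : R) :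
  is_mean E -> 0 < delta -> (0 < H)%N -> H%:R^-1 <= delta ^+ 2 / 2 ->
  bounded_real F ->
  (forall t, F t ^+ 2 * H%:R ^+ 2 <=
     (\sum_(h <- index_iota 0 H) cosp (phi h t)) ^+ 2 +
     (\sum_(h <- index_iota 0 H) sinp (phi h t)) ^+ 2) ->
  delta <= E F ->
  exists h k : nat, [/\ (0 < k)%N, (h + k < H)%N &
    delta ^+ 2 / 4 < E (fun t => cosp (phi (h + k)%N t - phi h t))].
Proof.
move=> mE d0 H0 Hd Fb Fle dF.
pose c i j := E (fun t => cosp (phi i t - phi j t)).
have cC i j : c i j = c j i.
  by congr E; apply/funext => t; rewrite -cospN opprB.
have F2b : bounded_real (fun t => F t ^+ 2) by apply: bounded_realM.
have HR : 0 < H%:R :> R by rewrite ltr0n.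
have dF2 : delta ^+ 2 <= E (fun t => F t ^+ 2).
  have : E (fun t => delta * F t + delta * F t) <= E (fun t => delta^+2 + F t ^+ 2).
    apply: (mean_le mE); first by apply: bounded_realD; exact: bounded_realZ.
      by apply: bounded_realD => //; exact: bounded_real_cst.
    move=> t; rewrite -subr_ge0.
    have -> : delta ^+ 2 + F t ^+ 2 - (delta * F t + delta * F t) =
      (delta - F t) ^+ 2 by ring.
    exact: sqr_ge0.
  rewrite (meanD mE); [|exact: bounded_realZ..].
  rewrite (meanD mE) ?(mean_cst mE) ?(meanZ mE)//; last exact: bounded_real_cst.
  by nra.
have F2c : E (fun t => F t ^+ 2) * H%:R ^+ 2 <=
    \sum_(i <- index_iota 0 H) \sum_(j <- index_iota 0 H) c i j.
  have cb i j : bounded_real (fun t => cosp (phi i t - phi j t)).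
    exact: bounded_cosp.
  rewrite mulrC -(meanZ mE)//.
  under eq_bigr do rewrite -(mean_sum mE)//.
  rewrite -(mean_sum mE); last by move=> i; apply: bounded_real_sum.
  apply: (mean_le mE); first exact: bounded_realZ.
    by apply: bounded_real_sum => i; apply: bounded_real_sum.
  by move=> t; rewrite mulrC -exp_sum_sq; exact: Fle.
have [//|no] := pselect (exists h k : nat, [/\ (0 < k)%N, (h + k < H)%N &
    delta ^+ 2 / 4 < c (h + k)%N h]).
have cle i j : (i < H)%N -> (j < H)%N ->
    c i j <= (i == j)%:R + delta ^+ 2 / 4.
  have dd : 0 <= delta ^+ 2 / 4 by rewrite divr_ge0 ?sqr_ge0.
  wlog ij : i j / (j <= i)%N.
    move=> W iH jH; have [|/ltnW] := leqP j i; first by move/W; apply.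
    by rewrite cC eq_sym => /W; apply.
  move=> iH jH; have [->|nij] := eqVneq i j.
    rewrite /c (_ : (fun t => _) = fun=> 1) ?(mean_cst mE) ?lerDl//.
    by apply/funext => t; rewrite subrr cosp_int ?int_num0.
  rewrite add0r leNgt; apply/negP => lt; apply: no.
  by exists j, (i - j)%N; rewrite subnKC// subn_gt0 ltn_neqAle eq_sym nij.
have : \sum_(i <- index_iota 0 H) \sum_(j <- index_iota 0 H) c i j <=
    H%:R + H%:R ^+ 2 * (delta ^+ 2 / 4).
  have -> : H%:R + H%:R ^+ 2 * (delta ^+ 2 / 4) =
     \sum_(0 <= i < H) (1 + H%:R * (delta ^+ 2 / 4)) :> R.
    by rewrite sumr_const_nat subn0 -[RHS]mulr_natr; ring.
  rewrite ler_sum_nat// => i /andP[_ iH].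
  apply: (@le_trans _ _ (\sum_(0 <= j < H) ((i == j)%:R + delta ^+ 2 / 4))).
    by apply: ler_sum_nat => j /andP[_ jH]; exact: cle.
  rewrite big_split /= sumr_const_nat subn0 -[X in _ + X <= _]mulr_natl lerD2r.
  rewrite (bigD1_seq i) ?mem_index_iota ?iota_uniq//= eqxx big1 ?addr0//.
  by move=> j; rewrite eq_sym => /negbTE ->.
move=> upper.
have : H%:R = H%:R^-1 * H%:R ^+ 2 :> R by field; rewrite lt0r_neq0.
have : 0 < H%:R ^+ 2 * delta ^+ 2 by rewrite mulr_gt0 ?exprn_gt0.
have : H%:R^-1 * H%:R ^+ 2 <= delta ^+ 2 / 2 * H%:R ^+ 2.
  by rewrite ler_wpM2r ?sqr_ge0.
have : delta ^+ 2 * H%:R ^+ 2 <= E (fun t => F t ^+ 2) * H%:R ^+ 2.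
  by rewrite ler_wpM2r ?sqr_ge0.
lra.
Qed.

(** * Polynomial phases *)

(** If [A] encodes the polynomial [n |-> A ((1 + 'X) ^+ n)], then multiplying
    by [c = (1 + 'X) ^+ k - 1] encodes its difference with step [k]; constants [c]
    give multiples of the polynomial. *)
Definition mulfun (R : realType) (A : {additive {poly int} -> R})
  (c p : {poly int}) : R := A (c * p).

Fact mulfun_is_zmod_morphism (R : realType) (A : {additive {poly int} -> R}) c :
  zmod_morphism (mulfun A c).
Proof. by move=> p q; rewrite /mulfun mulrBr raddfB. Qed.

HB.instance Definition _ (R : realType) (A : {additive {poly int} -> R}) c :=
  GRing.isZmodMorphism.Build {poly int} R (mulfun A c)
    (mulfun_is_zmod_morphism A c).

Section PolynomialPhases.
Context {R : realType} {M : (nat -> R) -> R}.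
Hypothesis mM : is_mean M.
Hypothesis shiftM : forall f, bounded_real f -> M (fun n => f n.+1) = M f.

Lemma mean_shift f k : bounded_real f -> M (fun n => f (n + k)%N) = M f.
Proof.
move=> fb; elim: k => [|k IH]; first by congr M; apply/funext => n; rewrite addn0.
rewrite -IH -[RHS]shiftM; last exact: (bounded_real_comp (fun n => n + k)%N).
by congr M; apply/funext => n; rewrite addSnnS.
Qed.

(** Translating by [P] multiplies the mean of [exp (2 i pi f)] by
    [exp (2 i pi theta)], so this mean vanishes unless [theta] is an integer. *)
Lemma mean_cosp_eigen f theta P :
  (forall n, f (n + P)%N - f n - theta \is a Num.int) ->
  0 < M (fun n => cosp (f n)) -> theta \is a Num.int.
Proof.
move=> fP C0; apply: cosp1_int.
have bc : bounded_real (fun n => cosp (f n)) by exact: bounded_cosp.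
have bs : bounded_real (fun n => sinp (f n)) by exact: bounded_sinp.
have cE : M (fun n => cosp (f n)) =
    cosp theta * M (fun n => cosp (f n)) + - sinp theta * M (fun n => sinp (f n)).
  rewrite -!(meanZ mM) //.
  rewrite -(meanD mM); [|exact: bounded_realZ..].
  rewrite -(mean_shift P bc).
  congr M; apply/funext => n.
  rewrite (_ : f (n + P)%N = (f n + theta) + (f (n + P)%N - f n - theta)); last ring.
  by rewrite (cospDint _ (fP n)) cospD; ring.
have sE : M (fun n => sinp (f n)) =
    cosp theta * M (fun n => sinp (f n)) + sinp theta * M (fun n => cosp (f n)).
  rewrite -!(meanZ mM) //.
  rewrite -(meanD mM); [|exact: bounded_realZ..].
  rewrite -(mean_shift P bs).
  congr M; apply/funext => n.
  rewrite (_ : f (n + P)%N = (f n + theta) + (f (n + P)%N - f n - theta)); last ring.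
  by rewrite (sinpDint _ (fP n)) sinpD; ring.
move: C0 cE sE; set C := M _; set S := M _ => C0 cE sE.
have CS : 0 < C ^+ 2 + S ^+ 2 by rewrite ltr_wpDr ?sqr_ge0// exprn_gt0.
have : (1 - cosp theta) * (C ^+ 2 + S ^+ 2) = 0.
  have -> : (1 - cosp theta) * (C ^+ 2 + S ^+ 2) =
    C * (C - (cosp theta * C + - sinp theta * S)) +
    S * (S - (cosp theta * S + sinp theta * C)) by ring.
  by rewrite -cE -sE !subrr !mulr0 addr0.
by move/eqP; rewrite mulf_eq0 (gt_eqF CS) orbF subr_eq0 => /eqP.
Qed.

Lemma small_inverse (delta : R) : 0 < delta ->
  exists2 H, (0 < H)%N & H%:R^-1 <= delta.
Proof.
move=> d0; exists (Num.truncn delta^-1).+1 => //.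
rewrite invf_ple ?posrE ?ltr0n//; apply: ltW.
by have := truncnS_gt delta^-1.
Qed.

Lemma exprD1_poly_div (k : nat) :
  exists r : {poly int}, (1 + 'X) ^+ k = 1 + 'X * r.
Proof.
elim: k => [|k [r IH]]; first by exists 0; rewrite expr0 mulr0 addr0.
by exists (1 + r + 'X * r); rewrite exprS IH; ring.
Qed.

Lemma exprD1_poly_div2 (k : nat) :
  exists r : {poly int}, (1 + 'X) ^+ k = 1 + 'X * (k%:R + 'X * r).
Proof.
elim: k => [|k [r IH]]; first by exists 0; rewrite expr0; ring.
exists (r + k%:R + 'X * r); rewrite exprS IH -natr1; ring.
Qed.

Lemma int_mulrn_dvd (x : R) q q' :
  (q %| q')%N -> x *+ q \is a Num.int -> x *+ q' \is a Num.int.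
Proof. by move=> /dvdnP[c ->]; rewrite mulnC mulrnA => xq; exact: rpredMn. Qed.

(** With [P = q * D`!], this follows from [i * 'C(P, i) = P * 'C(P - 1, i - 1)]
    and [i %| D`!]. Translating a polynomial phase by [P] thus leaves its
    higher terms unchanged modulo [q]. *)
Lemma dvdn_bin_fact q D i : (0 < i <= D)%N -> (q %| 'C(q * D`!, i))%N.
Proof.
move=> /andP[i0 iD]; case: (posnP q) => [->|q0]; first by rewrite mul0n bin0n gtn_eqF.
have /dvdnP[c Hc] : (i %| D`!)%N by rewrite dvdn_fact ?i0.
case: i i0 iD Hc => // i _ iD Hc.
have E := mul_bin_diag (q * D`!) i.
apply/dvdnP; exists (c * 'C((q * D`!).-1, i))%N.
by apply/eqP; rewrite -(eqn_pmul2l (ltn0Sn i)) -E {1}Hc; apply/eqP; ring.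
Qed.

(** The phase [n |-> A ((1 + 'X) ^+ n)] is the general polynomial of degree
    less than [D] in [n]: its coefficient on ['C(n, j)] is [A 'X^j]. Multiplying
    the argument of [A] by a multiple of ['X] lowers the degree, which is how
    finite differences act. So van der Corput differencing and induction bound
    the denominators of the coefficients of index at least [2]; modulo a
    bounded period the phase is then linear and [mean_cosp_eigen] applies. *)
Lemma weyl (D : nat) (delta : R) : 0 < delta -> exists2 q, (0 < q)%N &
  forall A : {additive {poly int} -> R}, (forall p, A ('X^D * p) = 0) ->
  delta < M (fun n => cosp (A ((1 + 'X) ^+ n))) ->
  forall p, A ('X * p) *+ q \is a Num.int.
Proof.
elim: D delta => [|D IH] delta d0.
  exists 1%N => // A A0 _ p; rewrite -['X * p]mul1r -(expr0 'X) A0.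
  by rewrite mul0rn int_num0.
have d2 : 0 < delta ^+ 2 / 2 by rewrite divr_gt0 ?exprn_gt0.
have d4 : 0 < delta ^+ 2 / 4 by rewrite divr_gt0 ?exprn_gt0.
have [H H0 Hd] := small_inverse d2.
have [q0 q00 Hq0] := IH _ d4.
pose q' := (q0 * H`! ^ D)%N.
have q'0 : (0 < q')%N by rewrite muln_gt0 q00 expn_gt0 fact_gt0.
pose P := (q' * D`!)%N.
have P0 : (0 < P)%N by rewrite muln_gt0 q'0 fact_gt0.
have q'P : (q' %| P)%N by exact: dvdn_mulr.
have q'bin i : (0 < i <= D)%N -> (q' %| 'C(P, i))%N by exact: dvdn_bin_fact.
clearbody P.
exists P => // A A0 dA.
(* Differencing: the coefficients of index at least [2] have denominator [q']. *)
have A2 p : A ('X^2 * p) *+ q' \is a Num.int.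
  have [h [k [k0 hk]]] : exists h k : nat, [/\ (0 < k)%N, (h + k < H)%N &
      delta ^+ 2 / 4 < M (fun n => cosp (A ((1 + 'X) ^+ (n + (h + k))) -
                                        A ((1 + 'X) ^+ (n + h))))].
    apply: (@phase_correlation _ _ _ H (fun h n => A ((1 + 'X) ^+ (n + h)))
      (fun n => H%:R^-1 * \sum_(h <- index_iota 0 H) cosp (A ((1 + 'X) ^+ (n + h))))
      _ mM d0) => //.
    - apply: bounded_realZ; apply: bounded_real_sum => h; exact: bounded_cosp.
    - move=> n; rewrite exprMn mulrAC -exprMn mulVf ?pnatr_eq0 -?lt0n//.
      by rewrite expr1n mul1r lerDl sqr_ge0.
    - rewrite (meanZ mM); last first.
        by apply: bounded_real_sum => h; exact: bounded_cosp.
      rewrite (mean_sum mM); last by move=> h; exact: bounded_cosp.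
      under eq_bigr => h _ do
        rewrite (@mean_shift (fun n => cosp (A ((1 + 'X) ^+ n))) h (bounded_cosp _)).
      rewrite sumr_const_nat subn0 -[X in _ * X]mulr_natl mulrA mulVf ?mul1r ?ltW//.
      by rewrite pnatr_eq0 -lt0n.
  have [r Hr] := exprD1_poly_div2 k.
  pose Ak : {additive {poly int} -> R} := mulfun A ((1 + 'X) ^+ k - 1).
  rewrite (_ : M _ = M (fun n => cosp (Ak ((1 + 'X) ^+ n)))); last first.
    rewrite -(@mean_shift (fun n => cosp (Ak ((1 + 'X) ^+ n))) h (bounded_cosp _)).
    congr M; apply/funext => n; congr cosp; rewrite -raddfB /= /mulfun; congr (A _).
    by rewrite !exprD; ring.
  have Ak0 p' : Ak ('X^D * p') = 0.
    rewrite /= /mulfun Hr [X in A X](_ : _ = 'X^(D.+1) * ((k%:R + 'X * r) * p')) ?A0//.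
    by rewrite (exprS _ D); ring.
  move=> /(Hq0 _ Ak0) AkZ.
  (* [k + 'X * r] is invertible modulo ['X^D] up to the integer [k ^ D]. *)
  have [S HS] : exists S : {poly int},
      (k%:R + 'X * r) * S = (k ^ D)%:R - 'X^D * (- r) ^+ D.
    exists (\sum_(i < D) k%:R ^+ (D.-1 - i) * (- ('X * r)) ^+ i).
    by rewrite -{1}['X * r]opprK -subrXX natrX -mulrN exprMn.
  have := AkZ (p * S); rewrite /= /mulfun Hr.
  rewrite [X in A X](_ : _ = 'X^2 * p * ((k%:R + 'X * r) * S)); last by ring.
  rewrite HS mulrBr raddfB /=.
  rewrite [X in _ - A X](_ : _ = 'X^(D.+1) * ('X * p * (- r) ^+ D)); last first.
    by rewrite (exprS _ D); ring.
  rewrite A0 subr0 mulr_natr raddfMn -mulrnA; apply: int_mulrn_dvd.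
  rewrite mulnC dvdn_mul// dvdn_exp2r// dvdn_fact// k0/=.
  by apply: ltnW; rewrite (leq_ltn_trans _ hk)// leq_addl.
have A2P p : A ('X^2 * p) *+ P \is a Num.int.
  by apply: int_mulrn_dvd (A2 p).
(* Modulo [1], translation by [P] adds the constant [P * A 'X] to the phase. *)
have A1 : A 'X *+ P \is a Num.int.
  apply: (@mean_cosp_eigen (fun n => A ((1 + 'X) ^+ n)) _ P); last first.
    exact: lt_trans dA.
  move=> n; rewrite exprD -raddfB -{2}[(1 + 'X) ^+ n]mulr1 -mulrBr.
  rewrite [1 + 'X]addrC [('X + 1) ^+ P]exprD1n big_ord_recl /= expr0 bin0 mulr1n.
  rewrite addrAC subrr add0r -(big_mkord xpredT (fun i => 'X^(bump 0 i) *+ 'C(P, bump 0 i))).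
  rewrite big_ltn//= expr1 bin1 mulrDr raddfD /=.
  have [r Hr] := exprD1_poly_div n.
  rewrite addrAC rpredD//.
    rewrite ['X + 1]addrC Hr [X in A X - _](_ : _ = 'X *+ P + 'X^2 * r *+ P); last first.
      by rewrite mulrnAr -mulrnDl; congr (_ *+ _); ring.
    by rewrite raddfD !raddfMn mulNrn addrAC subrr add0r; exact: A2P.
  rewrite mulr_sumr raddf_sum big_nat_cond rpred_sum// => i /andP[/andP[i0 iP] _].
  rewrite /bump leq0n add1n; have [iD|Di] := leqP i.+1 D.
    have /dvdnP[e ->] : (q' %| 'C(P, i.+1))%N by exact: q'bin.
    rewrite mulnC mulrnA mulrnAr mulrnAr raddfMn raddfMn; apply: rpredMn.
    case: i i0 {iP iD} => // i _.
    rewrite [X in A X](_ : _ = 'X^2 * ('X^i * (1 + 'X) ^+ n)) ?A2//.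
    by rewrite [1 + 'X]addrC !exprS expr0; ring.
  rewrite mulrnAr raddfMn [X in A X](_ : _ = 'X^(D.+1) * ('X^(i.+1 - D.+1) * ('X + 1) ^+ n)).
    by rewrite A0 mul0rn int_num0.
  by rewrite mulrA -exprD subnKC// mulrC.
elim/poly_ind => [|p c _]; first by rewrite mulr0 raddf0 mul0rn int_num0.
rewrite mulrDr raddfD mulrnDl rpredD//.
  by rewrite mulrCA -expr2 mulrC A2P.
rewrite mulrC mul_polyC -[c]intz scaler_int raddfMz /= pmulrn mulrzAC -pmulrn.
by rewrite rpredMz.
Qed.

(** Where [f] is an integer, so are all the multiples [h * f]: as with the
    Fejer kernel, the indicator of that event is at most the modulus of the
    average of their exponentials, so two of them are correlated and [weyl]
    applies to a multiple of [f]. It leaves the constant term free, which is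
    then controlled by any single integer value. *)
Lemma integral_phase (D : nat) (delta : R) : 0 < delta -> exists2 q, (0 < q)%N &
  forall A : {additive {poly int} -> R}, (forall p, A ('X^D * p) = 0) ->
  delta < M (fun n => (A ((1 + 'X) ^+ n) \is a Num.int)%:R) ->
  forall p, A p *+ q \is a Num.int.
Proof.
move=> d0.
have d2 : 0 < delta ^+ 2 / 2 by rewrite divr_gt0 ?exprn_gt0.
have d4 : 0 < delta ^+ 2 / 4 by rewrite divr_gt0 ?exprn_gt0.
have [H H0 Hd] := small_inverse d2.
have [q0 q00 Hq0] := weyl D d4.
exists (q0 * H`!)%N; first by rewrite muln_gt0 q00 fact_gt0.
move=> A A0 dA.
have [h [k [k0 hk]]] : exists h k : nat, [/\ (0 < k)%N, (h + k < H)%N &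
    delta ^+ 2 / 4 < M (fun n => cosp (A ((1 + 'X) ^+ n) *+ (h + k) -
                                      A ((1 + 'X) ^+ n) *+ h))].
  apply: (@phase_correlation _ _ _ H (fun h n => A ((1 + 'X) ^+ n) *+ h)
    (fun n => (A ((1 + 'X) ^+ n) \is a Num.int)%:R) _ mM d0) => //.
  - exact: bounded_real_bool.
  - move=> n; have [fZ|_] := boolP (A ((1 + 'X) ^+ n) \is a Num.int); last first.
      by rewrite expr0n mul0r addr_ge0 ?sqr_ge0.
    have -> : \sum_(h <- index_iota 0 H) cosp (A ((1 + 'X) ^+ n) *+ h) = H%:R.
      transitivity (\sum_(0 <= h < H) 1 : R); last by rewrite sumr_const_nat subn0.
      by apply: eq_bigr => h _; rewrite cosp_int// rpredMn.
    by rewrite expr1n mul1r lerDl sqr_ge0.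
  - exact: ltW.
pose Ak : {additive {poly int} -> R} := mulfun A k%:R.
rewrite (_ : M _ = M (fun n => cosp (Ak ((1 + 'X) ^+ n)))); last first.
  congr M; apply/funext => n; congr cosp.
  by rewrite mulrnDr addrAC subrr add0r /= /mulfun mulr_natl raddfMn.
have Ak0 p : Ak ('X^D * p) = 0 by rewrite /= /mulfun mulr_natl raddfMn A0 mul0rn.
move=> /(Hq0 _ Ak0) AkZ.
have AZ p : A ('X * p) *+ (q0 * H`!) \is a Num.int.
  have := AkZ p; rewrite /= /mulfun mulr_natl raddfMn -mulrnA; apply: int_mulrn_dvd.
  rewrite mulnC dvdn_mul// dvdn_fact// k0 /=.
  by apply: ltnW; rewrite (leq_ltn_trans _ hk)// leq_addl.
have [n] := mean_gt_ex mM (bounded_real_bool _) (lt_trans d0 dA).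
have [fZ _|_] := boolP (A ((1 + 'X) ^+ n) \is a Num.int); last by rewrite ltxx.
have [r Hr] := exprD1_poly_div n.
have A1 : A 1 *+ (q0 * H`!) \is a Num.int.
  have -> : 1 = (1 + 'X) ^+ n - 'X * r by rewrite Hr addrK.
  by rewrite raddfB mulrnBl rpredB// rpredMn.
elim/poly_ind => [|p c _]; first by rewrite raddf0 mul0rn int_num0.
rewrite raddfD mulrnDl mulrC rpredD//.
rewrite -[c%:P]mulr1 mul_polyC -[c]intz scaler_int raddfMz /= pmulrn mulrzAC -pmulrn.
by rewrite rpredMz.
Qed.

End PolynomialPhases.

(** * Integer characters and unipotent orbits *)

Definition phase (R : realType) (d : nat) (m : 'rV[int]_d) (x : 'cV[R]_d) : R :=
  (map_mx intr m *m x) 0 0.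

Lemma mulmxMnl (K : pzRingType) (a b c : nat) (A : 'M[K]_(a, b)) (B : 'M[K]_(b, c)) n :
  (A *+ n) *m B = (A *m B) *+ n.
Proof. by elim: n => [|n IH]; rewrite ?mulr0n ?mul0mx// !mulrS mulmxDl IH. Qed.

Lemma mulmxMnr (K : pzRingType) (a b c : nat) (A : 'M[K]_(a, b)) (B : 'M[K]_(b, c)) n :
  A *m (B *+ n) = (A *m B) *+ n.
Proof. by elim: n => [|n IH]; rewrite ?mulr0n ?mulmx0// !mulrS mulmxDr IH. Qed.

Section Phase.
Context {R : realType} {d : nat}.
Implicit Types (m : 'rV[int]_d) (x y : 'cV[R]_d).

Lemma phaseM m (g : 'M[int]_d) x :
  phase (m *m g) x = phase m (map_mx intr g *m x).
Proof. by rewrite /phase map_mxM mulmxA. Qed.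

Lemma phaseDl m m' x : phase (m + m') x = phase m x + phase m' x.
Proof. by rewrite /phase map_mxD mulmxDl mxE. Qed.

Lemma phase0l x : phase 0 x = 0.
Proof. by rewrite /phase map_mx0 mul0mx mxE. Qed.

Lemma phase_suml (I : Type) (r : seq I) (P : pred I) (f : I -> 'rV[int]_d) x :
  phase (\sum_(i <- r | P i) f i) x = \sum_(i <- r | P i) phase (f i) x.
Proof.
exact: (big_morph (fun m => phase m x) (fun a b => phaseDl a b x) (phase0l x)).
Qed.

Lemma phaseMnl m x n : phase (m *+ n) x = phase m x *+ n.
Proof.
by elim: n => [|n IH]; rewrite ?mulr0n ?phase0l// !mulrS phaseDl IH.
Qed.

Lemma phaseBr m x y : phase m (x - y) = phase m x - phase m y.
Proof. by rewrite /phase mulmxBr !mxE. Qed.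

Lemma phaseMnr m x n : phase m (x *+ n) = phase m x *+ n.
Proof.
rewrite /phase mulmxMnr; set A := map_mx _ _ *m x.
by elim: n => [|n IH]; [rewrite !mulr0n mxE|rewrite !mulrS mxE IH].
Qed.

End Phase.

Lemma coef_exprD1_poly (n j : nat) : ((1 + 'X : {poly int}) ^+ n)`_j = 'C(n, j)%:R.
Proof.
rewrite addrC exprD1n coef_sum.
under eq_bigr => i _ do rewrite coefMn coefXn.
have [jn|nj] := ltnP j n.+1.
  rewrite (bigD1 (Ordinal jn))//= eqxx big1 ?addr0// => i /eqP ij.
  by case: eqP => [ji|]; rewrite ?mul0rn//; case: ij; apply: val_inj.
rewrite bin_small// big1// => i _; case: eqP => [ji|]; rewrite ?mul0rn//.
by move: nj; rewrite ji leqNgt ltn_ord.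
Qed.

Section UnipotentPhase.
Context {R : realType} {d : nat}.
Variables (D : nat) (N : 'M[int]_d) (theta : R) (m : 'rV[int]_d) (x : 'cV[R]_d).

(** For [N] nilpotent, the encoding by a functional on [{poly int}] of the
    polynomial [n |-> theta + m ((1 + N) ^+ n x)], see [orbit_functional_expr]:
    ['X^j] goes to [m (N ^+ j x)], and [theta] is added to the constant term. *)
Definition orbit_functional (p : {poly int}) : R :=
  theta * (p`_0)%:~R + \sum_(j < D) phase (m *m N ^+ j) x * (p`_j)%:~R.

Fact orbit_functional_is_zmod_morphism : zmod_morphism orbit_functional.
Proof.
move=> p q; rewrite /orbit_functional coefB intrB mulrBr.
under eq_bigr => j _ do rewrite coefB intrB mulrBr.
by rewrite sumrB; ring.
Qed.

HB.instance Definition _ := GRing.isZmodMorphism.Build {poly int} R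
  orbit_functional orbit_functional_is_zmod_morphism.

Lemma orbit_functional_Xn p : (0 < D)%N -> orbit_functional ('X^D * p) = 0.
Proof.
move=> D0; rewrite /orbit_functional coefXnM D0 mulr0 add0r big1// => j _.
by rewrite coefXnM ltn_ord mulr0.
Qed.

Lemma orbit_functional_monomial j : (0 < j)%N -> (j < D)%N ->
  orbit_functional 'X^j = phase (m *m N ^+ j) x.
Proof.
move=> j0 jD; rewrite /orbit_functional coefXn eq_sym gtn_eqF// mulr0 add0r.
rewrite (bigD1 (Ordinal jD))//= coefXn eqxx mulr1 big1 ?addr0// => i ij.
by rewrite coefXn; case: eqP => [E|]; rewrite ?mulr0//; case/eqP: ij; apply: val_inj.
Qed.

Lemma orbit_functional_expr n : N ^+ D = 0 ->
  orbit_functional ((1 + 'X) ^+ n) = theta + phase (m *m (1 + N) ^+ n) x.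
Proof.
move=> ND; rewrite /orbit_functional coef_exprD1_poly bin0 mulr1; congr (_ + _).
rewrite [1 + N]addrC exprD1n mulmx_sumr phase_suml.
under eq_bigr => j _ do rewrite coef_exprD1_poly.
pose f j : R := phase (m *m N ^+ j) x * ('C(n, j)%:R)%:~R.
have fD j : (D <= j)%N -> f j = 0.
  move=> Dj; rewrite /f -(subnK Dj) exprD ND mulr0 mulmx0 phase0l mul0r //.
have fn j : (n < j)%N -> f j = 0.
  by move=> nj; rewrite /f bin_small// mulr0.
transitivity (\sum_(j < D + n.+1) f j).
  rewrite big_split_ord /= [X in _ + X]big1 ?addr0// => j _.
  by rewrite fD ?leq_addr.
rewrite addnC big_split_ord /= [X in _ + X]big1 ?addr0 => [|j _]; last first.
  by rewrite fn// ltnS leq_addr.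
by apply: eq_bigr => j _; rewrite /f mulmxMnr phaseMnl mulrz_nat mulr_natr.
Qed.

End UnipotentPhase.

Lemma common_multiple (n : nat) (Q : nat -> nat -> Prop) :
  (forall j q q', (q %| q')%N -> Q j q -> Q j q') ->
  (forall j, exists2 q, (0 < q)%N & Q j q) ->
  exists2 q, (0 < q)%N & forall j, (j < n)%N -> Q j q.
Proof.
move=> Qdvd Qex; elim: n => [|n [q q0 IH]]; first by exists 1%N.
have [q1 q10 Qq1] := Qex n; exists (q * q1)%N; first by rewrite muln_gt0 q0.
move=> j; rewrite ltnS leq_eqVlt => /predU1P[->|jn].
  by apply: Qdvd Qq1; exact: dvdn_mull.
by apply: Qdvd (IH _ jn); exact: dvdn_mulr.
Qed.

(** * Random words in unipotent letters *)

Fixpoint word_prod (d : nat) (w : seq 'M[int]_d) (t : seq nat) : 'M[int]_d :=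
  if w is u :: w' then u ^+ head 0 t *m word_prod w' (behead t) else 1%:M.

(** The exponent of the first letter is averaged innermost, with those of
    the later letters fixed. *)
Fixpoint word_mean (R : realType) (M : (nat -> R) -> R) (d : nat)
    (w : seq 'M[int]_d) (F : seq nat -> R) : R :=
  if w is u :: w' then word_mean M w' (fun t => M (fun n => F (n :: t)))
  else F [::].

Section Words.
Context {R : realType} {M : (nat -> R) -> R} {d : nat}.
Hypothesis mM : is_mean M.
Hypothesis shiftM : forall f, bounded_real f -> M (fun n => f n.+1) = M f.
Implicit Types (w : seq 'M[int]_d) (m : 'rV[int]_d) (x : 'cV[R]_d).

Lemma is_mean_word w : is_mean (word_mean M w).
Proof.
elim: w => [|u w IH]; first exact: (@is_mean_dirac R (seq nat) [::]).
exact: (@is_mean_bind _ _ _ _ _ _ (fun t n => n :: t) IH mM).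
Qed.

Lemma word_prod_nil w : word_prod w [::] = 1%:M.
Proof. by elim: w => //= u w ->; rewrite expr0 mul1mx. Qed.

Lemma word_prod_cat w1 w2 t1 t2 :
  exists t, word_prod (w1 ++ w2) t = word_prod w1 t1 *m word_prod w2 t2.
Proof.
elim: w1 t1 => [|u w1 IH] t1 /=; first by exists t2; rewrite mul1mx.
have [t Ht] := IH (behead t1).
by exists (head 0 t1 :: t); rewrite /= Ht mulmxA.
Qed.

Lemma word_prod_letter w u : u \in w -> exists t, word_prod w t = u.
Proof.
elim: w => // v w IH; rewrite inE => /predU1P[->|/IH[t Ht]].
  by exists [:: 1%N]; rewrite /= expr1 word_prod_nil mulmx1.
by exists (0 :: t); rewrite /= expr0 mul1mx.
Qed.

(** Averaging first over the exponent of the leftmost letter,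
    [integral_phase] shows that integrality for many exponents persists, up
    to a bounded multiple, for each coefficient of the corresponding
    polynomial; these coefficients are integer characters of the shorter word. *)
Lemma integral_word w m (delta : R) : (forall u, u \in w -> unipotent u) ->
  0 < delta -> exists2 q, (0 < q)%N & forall x,
  delta < word_mean M w
    (fun t => (phase (m *m word_prod w t) x \is a Num.int)%:R) ->
  forall t, phase (m *m word_prod w t) x *+ q \is a Num.int.
Proof.
elim: w m delta => [|u w IH] m delta uw d0.
  exists 1%N => // x /=.
  have [xZ _ t|_] := boolP (phase (m *m 1%:M) x \is a Num.int); first by [].
  by rewrite ltNge ltW.
have [D ND] : unipotent u by apply: uw; rewrite mem_head.
have {uw} uw v : v \in w -> unipotent v by move=> vw; apply: uw; rewrite inE vw orbT.
have d2 : 0 < delta / 2 by rewrite divr_gt0.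
have {}ND : (u - 1) ^+ D.+1 = 0 by rewrite exprS ND mulr0.
have [q0 q00 Hq0] := integral_phase mM shiftM D.+1 d2.
have [q1 q10 Hq1] := @common_multiple D.+1 (fun j q => forall x,
    delta / 2 < word_mean M w (fun t =>
      (phase ((m *m (u - 1) ^+ j *+ q0) *m word_prod w t) x \is a Num.int)%:R) ->
    forall t, phase ((m *m (u - 1) ^+ j *+ q0) *m word_prod w t) x *+ q
      \is a Num.int)
  (fun j q q' qq' H x Hx t => int_mulrn_dvd qq' (H x Hx t))
  (fun j => IH (m *m (u - 1) ^+ j *+ q0) _ uw d2).
exists (q0 * q1)%N => [|x dx t]; first by rewrite muln_gt0 q00.
pose A y : {additive {poly int} -> R} := orbit_functional D.+1 (u - 1) 0 m y.
have AE n y : A y ((1 + 'X) ^+ n) = phase (m *m u ^+ n) y.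
  by rewrite /= orbit_functional_expr// add0r addrC subrK.
have AX j y : (j < D.+1)%N -> A y 'X^j = phase (m *m (u - 1) ^+ j) y.
  case: j => [_|j jD]; last by rewrite /= orbit_functional_monomial.
  by have := AE 0 y; rewrite expr0 expr0 => ->; rewrite !expr0.
have key j t' : (j < D.+1)%N ->
    phase ((m *m (u - 1) ^+ j) *m word_prod w t') x *+ (q0 * q1) \is a Num.int.
  move=> jD; rewrite mulrnA -phaseMnl -mulmxMnl; apply: Hq1 => //.
  have mw := is_mean_word w.
  have bb : bounded_real (fun t : seq nat => M (fun n =>
      (phase (m *m (u ^+ n *m word_prod w t)) x \is a Num.int)%:R)).
    apply: (@bounded_real_mean _ _ _ _ _ 1 mM) => s n.
    by rewrite ger0_norm ?ler0n// lern1 leq_b1.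
  suff le : word_mean M (u :: w) (fun t =>
        (phase (m *m word_prod (u :: w) t) x \is a Num.int)%:R) <=
      delta / 2 + word_mean M w (fun t0 =>
        (phase ((m *m (u - 1) ^+ j *+ q0) *m word_prod w t0) x \is a Num.int)%:R).
    by move: (lt_le_trans dx le); rewrite -ltrBlDl; apply: le_lt_trans; lra.
  rewrite -[X in X + _](mean_cst mw) -(meanD mw); last 2 first.
  - exact: bounded_real_cst.
  - exact: bounded_real_bool.
  apply: (mean_le mw) => //.
    by apply: bounded_realD; [exact: bounded_real_cst|exact: bounded_real_bool].
  move=> s /=; set y := map_mx intr (word_prod w s) *m x.
  have -> : (fun n => (phase (m *m (u ^+ n *m word_prod w s)) x \is a Num.int)%:R)
     = fun n => (A y ((1 + 'X) ^+ n) \is a Num.int)%:R :> R.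
    by apply/funext => n; rewrite AE mulmxA phaseM.
  have [small|large] := leP (M (fun n => (A y ((1 + 'X) ^+ n) \is a Num.int)%:R))
    (delta / 2).
    by rewrite (le_trans small)// lerDl ler0n.
  have AZ := Hq0 (A y) (fun p => orbit_functional_Xn _ _ _ _ p (ltn0Sn D)) large.
  rewrite phaseM phaseMnl -/y -AX// AZ.
  rewrite (@le_trans _ _ 1)//; last by rewrite lerDr ltW.
  rewrite -[leRHS](mean_cst mM 1); apply: (mean_le mM).
  - exact: bounded_real_bool.
  - exact: bounded_real_cst.
  - by move=> n; rewrite lern1 leq_b1.
rewrite /= mulmxA; set n := head 0 t; set t' := behead t.
rewrite phaseM -AE; set y := map_mx _ _ *m x.
rewrite /= /orbit_functional mul0r add0r -sumrMnl rpred_sum// => j _.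
rewrite -mulrnAl rpredM ?intr_int//.
by rewrite -phaseM key.
Qed.

End Words.

(** * Irreducible actions *)

Section FamilyBasis.
Context {F : fieldType} {d : nat} {T : Type}.
Variable v : T -> 'rV[F]_d.

(** A maximal linearly independent subfamily of rows: as long as some member
    of the family does not vanish on the common kernel of the rows chosen so
    far, adding it keeps them independent. *)
Lemma family_basis : exists k (t : 'I_k -> T),
  let B := \matrix_(i < k) v (t i) in
  row_free B /\ forall x : 'cV[F]_d, B *m x = 0 -> forall s, v s *m x = 0.
Proof.
suff ext n k (t : 'I_k -> T) : (d - k <= n)%N -> row_free (\matrix_(i < k) v (t i)) ->
    exists k (t : 'I_k -> T), let B := \matrix_(i < k) v (t i) in
    row_free B /\ forall x : 'cV[F]_d, B *m x = 0 -> forall s, v s *m x = 0.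
  apply: (ext d 0%N (fun i => False_rect T (notF (ltn_ord i)))).
    by rewrite subn0.
  by rewrite /row_free -leqn0 rank_leq_row.
elim: n k t => [|n IH] k t kn free_t;
  set B := \matrix_(i < k) v (t i) in free_t *;
  have [done|] := pselect (forall x : 'cV[F]_d, B *m x = 0 -> forall s, v s *m x = 0).
- by exists k, t.
- move=> /existsNP[x /not_implyP[Bx /existsNP[s]]]; case.
  have full : row_full B.
    by rewrite /row_full (eqP free_t) eqn_leq -{1}(eqP free_t) rank_leq_col -subn_eq0 -leqn0.
  have [C CB] := row_fullP full.
  by rewrite -[x]mul1mx -CB -mulmxA Bx !mulmx0.
- by exists k, t.
- move=> /existsNP[x /not_implyP[Bx /existsNP[s vx]]].
  have kd : (k <= d)%N by rewrite -(eqP free_t) rank_leq_col.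
  pose t' (i : 'I_k.+1) := if unlift ord0 i is Some j then t j else s.
  apply: (IH _ t'); first by rewrite subnS -ltnS (leq_ltn_trans _ (ltnSn n))// -subn1 leq_subLR add1n.
  apply: inj_row_free => c; set B' := \matrix_i _ => cB.
  have cBE : c *m B' = c 0 ord0 *: v s + (\row_j c 0 (lift ord0 j)) *m B.
    rewrite mulmx_sum_row big_ord_recl rowK /t' unlift_none; congr (_ + _).
    rewrite mulmx_sum_row; apply: eq_bigr => j _.
    by rewrite !rowK mxE /t' liftK.
  have c0 : c 0 ord0 = 0.
    have := congr1 (mulmx^~ x) cB; rewrite /= cBE mulmxDl -mulmxA Bx mulmx0 addr0 mul0mx.
    by rewrite -scalemxAl => /eqP; rewrite scaler_eq0 => /orP[/eqP//|/eqP /vx].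
  move: cB; rewrite cBE c0 scale0r add0r => cB.
  have := row_free_inj free_t; move=> /(_ _ (\row_j c 0 (lift ord0 j)) 0).
  rewrite mul0mx => /(_ cB) c1; apply/rowP => j; rewrite mxE.
  case: (unliftP ord0 j) => [i ->|-> //].
  by have := congr1 (fun r : 'rV_k => r 0 i) c1; rewrite !mxE.
Qed.

End FamilyBasis.

Section Stabilizers.
Context {R : realType} {d : nat}.
Implicit Types (G : set 'M[int]_d).

Lemma SLZ_unitmx (g : 'M[int]_d) : SLZ d g -> g \in unitmx.
Proof. by rewrite /SLZ/= unitmxE => ->; rewrite unitr1. Qed.

Lemma SLZ_invmx (g : 'M[int]_d) : SLZ d g -> SLZ d (invmx g).
Proof. by move=> Hg; rewrite /SLZ/= det_inv Hg invr1. Qed.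

Lemma SLZM (g h : 'M[int]_d) : SLZ d g -> SLZ d h -> SLZ d (g *m h).
Proof. by rewrite /SLZ/= det_mulmx => -> ->; rewrite mulr1. Qed.

(** Adding [SLZ d] to [P] matters: the elements for which [P] holds form a
    competitor in the intersection defining the generated subgroup only if they
    have determinant one. *)
Lemma generated_invariant (s : seq 'M[int]_d) (P : 'M[int]_d -> Prop) G :
  is_SLZ_subgroup G -> G = SLZ_generated [set` s] ->
  P 1%:M -> (forall g h, P g -> P h -> P (g *m h)) ->
  (forall g, SLZ d g -> P g -> P (invmx g)) ->
  (forall g, g \in s -> P g) -> forall g, G g -> P g.
Proof.
move=> [GS G1 GM GV] Gs P1 PM PV Ps g.
have sG : [set` s] `<=` G by rewrite Gs; exact: sub_smallest.
suff : G `<=` [set g | SLZ d g /\ P g] by move=> + Gg => /(_ g Gg)[].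
rewrite Gs; apply: smallest_sub.
  split=> [h []//||h k [hS hP] [kS kP]|h [hS hP]].
  - by split=> //; exact: (GS _ G1).
  - by split; [exact: SLZM|exact: PM].
  - by split; [exact: SLZ_invmx|exact: PV].
by move=> h sh; split; [exact: GS (sG _ sh)|exact: Ps].
Qed.

Lemma map_invmxK (g : 'M[int]_d) (x : 'cV[R]_d) : SLZ d g ->
  map_mx intr (invmx g) *m (map_mx intr g *m x) = x.
Proof.
move=> /SLZ_unitmx ug; rewrite mulmxA -map_mxM mulVmx//.
by rewrite map_mx1 mul1mx.
Qed.

(** An injective map that sends a finite-dimensional space into itself is
    onto, so stability passes to the inverse. *)
Lemma stable_invmx (U : {vspace 'cV[R]_d}) (g : 'M[int]_d) : SLZ d g ->
  (forall x, x \in U -> map_mx intr g *m x \in U) ->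
  forall x, x \in U -> map_mx intr (invmx g) *m x \in U.
Proof.
move=> gS gU x xU.
pose f : 'End('cV[R]_d) := linfun (mulmx (map_mx intr g)).
have fE y : f y = map_mx intr g *m y by rewrite lfunE.
have fU : (f @: U <= U)%VS.
  by apply/subvP => y /memv_imgP[z zU ->]; rewrite fE gU.
have fI : (U :&: lker f)%VS == 0%VS.
  apply/eqP/vspaceP => y; rewrite memv_cap memv0; apply/idP/idP => [/andP[_]|/eqP ->].
    by rewrite memv_ker fE => /eqP gy; rewrite -(map_invmxK y gS) gy mulmx0.
  by rewrite !mem0v.
have : x \in (f @: U)%VS.
  suff -> : (f @: U)%VS = U by [].
  by apply/eqP; rewrite eqEdim fU limg_dim_eq ?leqnn//; exact/eqP.
by move=> /memv_imgP[z zU ->]; rewrite fE map_invmxK.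
Qed.

Lemma generated_stable (s : seq 'M[int]_d) G (U : {vspace 'cV[R]_d}) :
  is_SLZ_subgroup G -> G = SLZ_generated [set` s] ->
  (forall g, g \in s -> forall x, x \in U -> map_mx intr g *m x \in U) ->
  forall g, G g -> forall x, x \in U -> map_mx intr g *m x \in U.
Proof.
move=> GS Gs sU; apply: (generated_invariant GS Gs) => //.
- by move=> x xU; rewrite map_mx1 mul1mx.
- by move=> g h gU hU x xU; rewrite map_mxM -mulmxA gU// hU.
- by move=> g gS gU x xU; apply: stable_invmx.
Qed.

Lemma intr_mx_sqr_eq0 (m : 'rV[int]_d) :
  map_mx intr m *m (map_mx intr m)^T = 0 :> 'M[R]_1 -> m = 0.
Proof.
move=> /(congr1 (fun A : 'M[R]_1 => A 0 0)); rewrite !mxE => /eqP.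
rewrite psumr_eq0 => [/allP m0|j _]; last by rewrite !mxE -expr2 sqr_ge0.
apply/rowP => j; have := m0 j (mem_index_enum _); rewrite !mxE mulf_eq0 orbb.
by rewrite intr_eq0 => /eqP.
Qed.

(** A nonzero integer row fixed by every generator would have a kernel that
    is a proper nonzero invariant subspace. *)
Lemma moved_character (s : seq 'M[int]_d) G (m : 'rV[int]_d) : (2 <= d)%N ->
  is_SLZ_subgroup G -> G = SLZ_generated [set` s] -> irreducible_action R G ->
  m != 0 -> exists2 u, u \in s & m *m u != m.
Proof.
move=> d2 GS Gs [_ irr] m0.
have [//|no] := pselect (exists2 u, u \in s & m *m u != m).
have fixm u : u \in s -> m *m u = m.
  by move=> us; apply/eqP/negPn/negP => mu; apply: no; exists u.
pose f : 'Hom('cV[R]_d, 'cV[R]_1) := linfun (mulmx (map_mx intr m)).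
have fE y : f y = map_mx intr m *m y by rewrite lfunE.
have fx x : (x \in lker f) = (map_mx intr m *m x == 0) by rewrite memv_ker fE.
have : forall g, G g -> forall x, x \in lker f -> map_mx intr g *m x \in lker f.
  apply: (generated_stable GS Gs) => u us x; rewrite !fx mulmxA -map_mxM.
  by rewrite fixm.
move=> /irr[ker0|kerT].
  have : cokermx (map_mx intr m : 'M[R]_(1, d)) = 0.
    apply/matrixP => i j; rewrite [RHS]mxE.
    have : col j (cokermx (map_mx intr m : 'M[R]_(1, d))) \in lker f.
      by rewrite fx colE mulmxA mulmx_coker mul0mx.
    by rewrite ker0 memv0 => /eqP/(congr1 (fun A : 'cV[R]_d => A i 0)); rewrite !mxE.
  move=> /(congr1 (fun A => \rank A)); rewrite mxrank_coker mxrank0 => /eqP.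
  rewrite subn_eq0 => dm; have := leq_trans dm (rank_leq_row _).
  by rewrite leqNgt d2.
have : (map_mx intr m)^T \in lker f by rewrite kerT memvf.
by rewrite fx => /eqP /intr_mx_sqr_eq0 /eqP; rewrite (negbTE m0).
Qed.

Definition word_power (k : nat) (s : seq 'M[int]_d) := flatten (nseq k s).

Lemma word_powerD a b s : word_power (a + b) s = word_power a s ++ word_power b s.
Proof. by rewrite /word_power nseqD flatten_cat. Qed.

Lemma word_power_mem k s u : u \in word_power k s -> u \in s.
Proof. by move=> /flattenP[w /nseqP[-> _]]. Qed.

(** The common kernel of the rows [m *m g], for [g] a word in the generators,
    is an invariant subspace not containing [m^T], so it is zero; hence [d] of
    these rows form an integer matrix of nonzero determinant [Q], and
    Cramer's rule recovers [Q x] from the values of the rows at [x]. *)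
Lemma integral_orbit_torsion (s : seq 'M[int]_d) G (m : 'rV[int]_d) :
  is_SLZ_subgroup G -> G = SLZ_generated [set` s] -> irreducible_action R G ->
  m != 0 -> exists2 Q, (0 < Q)%N & exists k0, forall k, (k0 <= k)%N ->
  forall x : 'cV[R]_d,
  (forall t, phase (m *m word_prod (word_power k s) t) x \is a Num.int) ->
  forall i, x i 0 *+ Q \is a Num.int.
Proof.
move=> GS Gs [_ irr] m0.
pose vz (kt : nat * seq nat) := m *m word_prod (word_power kt.1 s) kt.2.
pose v kt : 'rV[R]_d := map_mx intr (vz kt).
have [r [t [freeB kerB]]] := family_basis v.
set B := \matrix_i _ in freeB kerB.
pose f : 'Hom('cV[R]_d, 'cV[R]_r) := linfun (mulmx B).
have fx x : (x \in lker f) = (B *m x == 0) by rewrite memv_ker lfunE.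
have kerv x : x \in lker f <-> forall kt, v kt *m x = 0.
  rewrite fx; split=> [/eqP/kerB //|vx0]; apply/eqP/row_matrixP => i.
  by rewrite row_mul rowK vx0 row0.
have : forall g, G g -> forall x, x \in lker f -> map_mx intr g *m x \in lker f.
  apply: (generated_stable GS Gs) => u us x /kerv vx; apply/kerv => -[k t0].
  have [t1 t1u] := word_prod_letter us.
  have [t2 t2u] := word_prod_cat (word_power k s) s t0 t1.
  have := vx (k + 1, t2)%N; rewrite /v /vz /= word_powerD {2}/word_power /= cats0.
  by rewrite t2u t1u mulmxA map_mxM mulmxA.
move=> /irr[ker0|kerT]; last first.
  have : (map_mx intr m)^T \in lker f by rewrite kerT memvf.
  move=> /kerv /(_ (0%N, [::])); rewrite /v /vz /= mulmx1.
  by move=> /intr_mx_sqr_eq0 /eqP; rewrite (negbTE m0).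
have rd : r = d.
  apply/eqP; rewrite eqn_leq -{1}(eqP freeB) rank_leq_col/=.
  have : row_free B^T.
    apply: inj_row_free => c cB; apply: trmx_inj; rewrite trmx0.
    have : c^T \in lker f by rewrite fx -[B]trmxK -trmx_mul cB trmx0.
    by rewrite ker0 memv0 => /eqP.
  by rewrite /row_free mxrank_tr => /eqP rB; rewrite -{1}rB rank_leq_row.
subst r.
pose Bz := \matrix_i vz (t i).
have BE : B = map_mx intr Bz by apply/matrixP => i j; rewrite !mxE.
have detB : \det Bz != 0.
  have : B \in unitmx by rewrite -row_free_unit.
  by rewrite unitmxE BE det_map_mx unitfE intr_eq0.
exists `|\det Bz|%N; first by rewrite absz_gt0.
exists (\max_(i < d) (t i).1)%N => k kk x xZ i.
have BxZ j : (B *m x) j 0 \is a Num.int.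
  have : row j B *m x = v (t j) *m x by rewrite rowK.
  rewrite -row_mul => /(congr1 (fun A : 'M[R]_1 => A 0 0)); rewrite mxE => ->.
  have le : ((t j).1 <= k)%N by apply: leq_trans kk; exact: (leq_bigmax (F := fun i => (t i).1)).
  have [t1 Ht1] := word_prod_cat (word_power (t j).1 s) (word_power (k - (t j).1) s)
    (t j).2 [::].
  by have := xZ t1; rewrite -{1}(subnKC le) word_powerD Ht1 word_prod_nil mulmx1.
have : (\det Bz)%:~R * x i 0 \is a Num.int.
  have -> : (\det Bz)%:~R * x i 0 = (map_mx intr (\adj Bz) *m (B *m x)) i 0.
    by rewrite mulmxA BE -map_mxM mul_adj_mx map_scalar_mx mul_scalar_mx mxE.
  by rewrite mxE rpred_sum// => j _; rewrite rpredM// mxE intr_int.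
rewrite -mulr_natl; case: (\det Bz) => a //.
by rewrite NegzE abszN mulrNz mulNr rpredN.
Qed.

End Stabilizers.

(** * Decay of characters along the group *)

Lemma first_occurrence (T : eqType) (P : pred T) (s : seq T) : has P s ->
  exists s1 u s2, [/\ s = s1 ++ u :: s2, P u & forall v, v \in s1 -> ~~ P v].
Proof.
elim: s => //= x s IH; have [Px _|nPx /= /IH[s1 [u [s2 [-> Pu Ps1]]]]] := boolP (P x).
  by exists [::], x, s.
by exists (x :: s1), u, s2; split=> // v; rewrite inE => /predU1P[->|/Ps1].
Qed.

Section Decay.
Context {R : realType} {M : (nat -> R) -> R} {d : nat}.
Hypothesis mM : is_mean M.
Hypothesis shiftM : forall f, bounded_real f -> M (fun n => f n.+1) = M f.

(** Stated for a function of the row [m *m g] so that it applies to phases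
    with an arbitrary constant term. *)
Lemma word_mean_fixed_prefix (w1 w2 : seq 'M[int]_d) (m : 'rV[int]_d)
    (g : 'rV[int]_d -> R) : (forall v, v \in w1 -> m *m v = m) ->
  word_mean M (w1 ++ w2) (fun t => g (m *m word_prod (w1 ++ w2) t)) =
  word_mean M w2 (fun t => g (m *m word_prod w2 t)).
Proof.
elim: w1 => // v w1 IH fix_m /=.
have vm n : m *m v ^+ n = m.
  elim: n => [|n IHn]; first by rewrite expr0 mulmx1.
  by rewrite exprSr mulmxA IHn fix_m ?mem_head.
rewrite -IH => [|u uw]; last by apply: fix_m; rewrite inE uw orbT.
congr word_mean; apply/funext => t.
rewrite -[RHS](mean_cst mM); congr M; apply/funext => n.
by rewrite /= mulmxA vm.
Qed.

(** Averages of a nontrivial character along the group are small except at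
    torsion points of bounded order: a letter that moves the character yields,
    by [weyl], integrality of a nonzero character along the rest of the word,
    and [integral_word] with [integral_orbit_torsion] turn this into torsion. *)
Lemma character_decay (s : seq 'M[int]_d) (G : set 'M[int]_d) (m : 'rV[int]_d)
    (delta : R) : (2 <= d)%N ->
  is_SLZ_subgroup G -> G = SLZ_generated [set` s] ->
  (forall g, g \in s -> unipotent g) -> irreducible_action R G ->
  m != 0 -> 0 < delta ->
  exists k0, forall k, (k0 <= k)%N -> exists2 Q, (0 < Q)%N & forall theta x,
    delta < word_mean M (word_power k s)
      (fun t => cosp (theta + phase (m *m word_prod (word_power k s) t) x)) ->
    forall i, x i 0 *+ Q \is a Num.int.
Proof.
move=> d2 GS Gs us irr m0 d0.
have [u0 u0s mu0] := moved_character d2 GS Gs irr m0.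
have [s1 [u [s2 [sE mu fix1]]]] : exists s1 u s2, [/\ s = s1 ++ u :: s2,
    m *m u != m & forall v, v \in s1 -> ~~ (m *m v != m)].
  by apply: (@first_occurrence _ (fun u => m *m u != m)); apply/hasP; exists u0.
have uS : u \in s by rewrite sE mem_cat mem_head orbT.
have [D0 ND0] := us u uS.
(* The exponent is enlarged so that the linear coefficient has index below [D]. *)
pose D := D0.+2.
have ND : (u - 1) ^+ D = 0 by rewrite !exprS ND0 !mulr0.
set N := u - 1 in ND.
have mN0 : m *m N != 0.
  by rewrite /N mulmxBr subr_eq0 (_ : m *m 1 = m)// mulmx1.
have dd : 0 < delta / 2 by rewrite divr_gt0.
have [q0 q00 Hq0] := weyl mM shiftM D dd.
have [Q1 Q10 [k1 Hk1]] := integral_orbit_torsion GS Gs irr mN0.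
exists k1.+1 => -[//|k] kk.
pose w := s2 ++ word_power k s.
have wu v : v \in w -> unipotent v.
  rewrite mem_cat => /orP[vs2|/word_power_mem/us//].
  by apply: us; rewrite sE mem_cat inE vs2 !orbT.
have [q1 q10 Hq1] := integral_word mM shiftM (m *m N *+ q0) wu dd.
exists (q0 * q1 * Q1)%N => [|theta x]; first by rewrite !muln_gt0 q00 q10.
have -> : word_power k.+1 s = s1 ++ u :: w by rewrite /word_power/= {1}sE -catA.
rewrite (word_mean_fixed_prefix (u :: w) (fun m' => cosp (theta + phase m' x)));
  last by move=> v /fix1; rewrite negbK => /eqP.
move=> dx.
have mw := is_mean_word mM w.
have le : word_mean M (u :: w)
      (fun t => cosp (theta + phase (m *m word_prod (u :: w) t) x)) <=
    delta / 2 + word_mean M w (fun t =>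
      (phase (m *m N *+ q0 *m word_prod w t) x \is a Num.int)%:R).
  rewrite -[X in X + _](mean_cst mw) -(meanD mw); last 2 first.
  - exact: bounded_real_cst.
  - exact: bounded_real_bool.
  apply: (mean_le mw).
  - by apply: (@bounded_real_mean _ _ _ _ _ 1 mM) => t n; exact: cosp_max.
  - by apply: bounded_realD; [exact: bounded_real_cst|exact: bounded_real_bool].
  move=> t /=; set y := map_mx intr (word_prod w t) *m x.
  pose A : {additive {poly int} -> R} := orbit_functional D N theta m y.
  have -> : (fun n => cosp (theta + phase (m *m (u ^+ n *m word_prod w t)) x)) =
      fun n => cosp (A ((1 + 'X) ^+ n)).
    apply/funext => n; rewrite /= orbit_functional_expr//.
    by rewrite (_ : 1 + N = u) ?mulmxA ?phaseM// /N addrC subrK.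
  have [small|large] := leP (M (fun n => cosp (A ((1 + 'X) ^+ n)))) (delta / 2).
    by rewrite (le_trans small)// lerDl ler0n.
  have AX : A 'X *+ q0 \is a Num.int.
    rewrite -['X]mulr1; apply: Hq0 => // p; exact: orbit_functional_Xn.
  have -> : phase (m *m N *+ q0 *m word_prod w t) x \is a Num.int.
    rewrite phaseM phaseMnl -/y -[N]expr1.
    by rewrite -(@orbit_functional_monomial _ _ D N theta m y 1%N) ?expr1.
  rewrite (@le_trans _ _ 1)//; last by rewrite lerDr ltW.
  rewrite -[leRHS](mean_cst mM 1); apply: (mean_le mM).
  - exact: bounded_cosp.
  - exact: bounded_real_cst.
  - by move=> n; exact: cos_le1.
have {le} dx' : delta / 2 < word_mean M w (fun t =>
      (phase (m *m N *+ q0 *m word_prod w t) x \is a Num.int)%:R).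
  by move: (lt_le_trans dx le); rewrite -ltrBlDl; apply: le_lt_trans; lra.
move=> i; have : (x *+ (q0 * q1)) i 0 *+ Q1 \is a Num.int.
  apply: (Hk1 k) => // t.
  have [t' Ht'] := word_prod_cat s2 (word_power k s) [::] t.
  have := Hq1 x dx' t'; rewrite Ht' word_prod_nil mul1mx phaseMnr.
  by rewrite mulmxMnl phaseMnl mulrnA.
have -> : (x *+ (q0 * q1)) i 0 = x i 0 *+ (q0 * q1).
  by elim: (q0 * q1)%N => [|n IH]; [rewrite !mulr0n mxE|rewrite !mulrS mxE IH].
by rewrite -mulrnA.
Qed.

End Decay.

(** * A trigonometric kernel and density *)

Section CosinePowers.
Context {R : realType}.

Definition cexp (t : R) : R[i] := Complex (cosp t) (sinp t).

Lemma cexpD s t : cexp (s + t) = cexp s * cexp t.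
Proof. by rewrite /cexp cospD sinpD; apply/eqP; rewrite eq_complex /= !eqxx addrC eqxx. Qed.

Lemma cexp0 : cexp 0 = 1.
Proof. by rewrite /cexp cosp_int ?sinp_int ?int_num0. Qed.

Lemma cexpM t n : cexp t ^+ n = cexp (t *+ n).
Proof. by elim: n => [|n IH]; rewrite ?expr0 ?mulr0n ?cexp0// exprS IH mulrS cexpD. Qed.

(** The left side is [cos (pi y) ^+ (2 * L)], the [2 * L]-th power of the half
    sum of [cexp (y / 2)] and its inverse. *)
Lemma cosp_half_expansion (L : nat) (y : R) :
  ((((1 + cosp y) / 2) ^+ L)%:C)%C = \sum_(k < (2 * L).+1)
    (('C(2 * L, k)%:R / 4 ^+ L)%:C)%C * cexp (((k : nat)%:Z - L%:Z)%:~R * y).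
Proof.
have half : (1 + cosp y) / 2 = (4^-1 * (2 * cosp (y / 2)) ^+ 2).
  have -> : cosp y = cosp (y / 2) ^+ 2 - sinp (y / 2) ^+ 2.
    by rewrite {1}(splitr y) cospD !expr2.
  have := cosp2Dsinp2 (y / 2); rewrite exprMn => h.
  have -> : sinp (y / 2) ^+ 2 = 1 - cosp (y / 2) ^+ 2 by lra.
  by field.
have e2 : ((2 * cosp (y / 2))%:C)%C = cexp (- (y / 2)) + cexp (y / 2).
  rewrite /cexp cospN sinpN; apply/eqP; rewrite eq_complex /= addNr eqxx andbT.
  by apply/eqP; rewrite mulr_natl mulr2n.
rewrite half exprMn -exprM rmorphM /= [X in _ * X]rmorphXn /= e2 exprDn mulr_sumr.
apply: eq_bigr => k _; rewrite -[_ *+ 'C(_, _)]mulr_natl !cexpM -cexpD.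
rewrite mulrA; congr (_ * cexp _).
  by rewrite [in RHS]rmorphM /= rmorph_nat mulrC exprVn.
have k2L : (k <= 2 * L)%N by rewrite -ltnS.
rewrite -[- (y / 2) *+ _]mulr_natr -[y / 2 *+ k]mulr_natr natrB// natrM.
rewrite intrB -!pmulrn; move: (k%:R : R) (L%:R : R) => a b.
by field.
Qed.

End CosinePowers.

Section Kernel.
Context {R : realType} (D L : nat).

Definition cos_kernel (x : 'cV[R]_D) : R := \prod_i ((1 + cosp (x i 0)) / 2) ^+ L.

Definition freq (kappa : {ffun 'I_D -> 'I_(2 * L).+1}) : 'rV[int]_D :=
  \row_i ((kappa i : nat)%:Z - L%:Z).

Definition weight (kappa : {ffun 'I_D -> 'I_(2 * L).+1}) : R :=
  \prod_i ('C(2 * L, kappa i)%:R / 4 ^+ L).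

Definition freq0_index : {ffun 'I_D -> 'I_(2 * L).+1} := [ffun=> inord L].

Lemma weight_ge0 kappa : 0 <= weight kappa.
Proof. by apply: prodr_ge0 => i _; rewrite divr_ge0 ?exprn_ge0. Qed.

Lemma freq_eq0 kappa : freq kappa = 0 -> kappa = freq0_index.
Proof.
move=> k0; apply/ffunP => i; rewrite ffunE; apply: val_inj => /=.
have L2 : (L < (2 * L).+1)%N by rewrite ltnS mul2n -addnn leq_addr.
rewrite inordK//; have := congr1 (fun r : 'rV_D => r 0 i) k0; rewrite !mxE.
by move=> /eqP; rewrite subr_eq0 => /eqP[].
Qed.

Lemma freq_freq0_index : freq freq0_index = 0.
Proof.
apply/rowP => i; rewrite !mxE ffunE inordK ?subrr//.
by rewrite ltnS mul2n -addnn leq_addr.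
Qed.

Lemma phase_freq kappa (x : 'cV[R]_D) :
  phase (freq kappa) x = \sum_i ((kappa i : nat)%:Z - L%:Z)%:~R * x i 0.
Proof. by rewrite /phase mxE; apply: eq_bigr => i _; rewrite !mxE. Qed.

Lemma cos_kernel_expansion (x : 'cV[R]_D) :
  cos_kernel x = \sum_kappa weight kappa * cosp (phase (freq kappa) x).
Proof.
have : ((cos_kernel x)%:C)%C = \sum_kappa ((weight kappa)%:C)%C * cexp (phase (freq kappa) x).
  rewrite /cos_kernel rmorph_prod /=.
  under eq_bigr => i _ do rewrite cosp_half_expansion.
  rewrite bigA_distr_bigA /=; apply: eq_bigr => kappa _.
  rewrite big_split /= rmorph_prod /=; congr (_ * _).
  by rewrite phase_freq (big_morph _ cexpD cexp0).
move=> /(congr1 (@complex.Re R)); rewrite raddf_sum /= => ->.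
by apply: eq_bigr => kappa _; rewrite mul0r subr0.
Qed.

Lemma sum_weight : \sum_kappa weight kappa = 1.
Proof.
have := cos_kernel_expansion 0; rewrite /cos_kernel big1 => [->|i _].
  apply: eq_bigr => kappa _; rewrite phase_freq big1 ?cosp_int ?int_num0 ?mulr1//.
  by move=> i _; rewrite mxE mulr0.
by rewrite mxE cosp_int ?int_num0// -(natrD _ 1 1) divff ?expr1n.
Qed.

End Kernel.

(** A polynomial lower bound for the mean [4 ^- L * 'C(2 * L, L)] of the kernel
    in one variable, by induction from
    [L.+1 * 'C(2 * L + 2, L + 1) = 2 * (2 * L + 1) * 'C(2 * L, L)]. *)
Lemma central_bin_lower L : (0 < L)%N -> (4 ^ L <= 2 * L * 'C(2 * L, L))%N.
Proof.
case: L => // L _; elim: L => [|L IH] //.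
have A := mul_bin_diag (2 * L.+1).+2 L.+1; have B := mul_bin_diag (2 * L.+1).+1 L.+1.
have C : 'C((2 * L.+1).+1, L.+1) = 'C((2 * L.+1).+1, L.+2).
  by rewrite -bin_sub; [congr binomial|]; lia.
rewrite /= in A B; rewrite (_ : (2 * L.+2 = (2 * L.+1).+2)%N); last by lia.
rewrite C in A; rewrite (_ : (2 * L.+1).+2 = 2 * L.+2)%N in A; last by lia.
rewrite (_ : (2 * L.+1).+2 = 2 * L.+2)%N; last by lia.
rewrite expnS -[X in (_ <= X)%N]mulnA -A -(mulnA 2%N L.+2) -B
  [(_.+1 * 'C(2 * L.+1, _))%N]mulSn.
move: IH; generalize (2 * L.+1 * 'C(2 * L.+1, L.+1))%N => c.
by generalize (4 ^ L.+1)%N => p; lia.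
Qed.

Lemma bernoulli_le (R : realType) (h : R) (n : nat) :
  0 <= h -> 1 + n%:R * h <= (1 + h) ^+ n.
Proof.
move=> h0; elim: n => [|n IH]; first by rewrite mul0r addr0 expr0.
rewrite exprS -natr1; have : 0 <= n%:R * h by rewrite mulr_ge0.
have : (1 + h) * (1 + n%:R * h) <= (1 + h) * (1 + h) ^+ n.
  by rewrite ler_wpM2l// addr_ge0.
nra.
Qed.

(** [rho ^+ L] is the size of the kernel away from the origin and the right side
    a lower bound for its mean. The exponent is taken divisible by [2 * D]: then
    the [D]-th root of the claim follows from the square of Bernoulli's
    inequality. *)
Lemma geometric_beats_power (R : realType) (D : nat) (rho : R) :
  (0 < D)%N -> 0 < rho < 1 ->
  exists2 L, (0 < L)%N & rho ^+ L < ((2 * L)%:R^-1) ^+ D.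
Proof.
move=> D0 /andP[r0 r1].
have [h h0 rE] : exists2 h, 0 < h & rho = (1 + h)^-1.
  by exists (rho^-1 - 1); rewrite ?subr_gt0 ?invf_gt1// addrC subrK invrK.
have D0' : 0 < D%:R :> R by rewrite ltr0n.
have e0 : 0 < h ^+ 2 / (4 * D%:R) by rewrite divr_gt0 ?mulr_gt0 ?exprn_gt0.
have [j j0 Hj] := small_inverse e0.
have jR : 0 < j%:R :> R by rewrite ltr0n.
exists (j * 2 * D)%N; first by rewrite !muln_gt0 j0.
have LR : 0 < (2 * (j * 2 * D))%:R :> R by rewrite ltr0n !muln_gt0 j0.
rewrite exprM ltr_pXn2r ?nnegrE ?exprn_ge0 ?invr_ge0 ?(ltW LR) ?(ltW r0)//.
rewrite {1}rE exprVn ltf_pV2 ?posrE ?exprn_gt0 ?addr_gt0//.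
have jh : 4 * D%:R <= j%:R * h ^+ 2.
  by move: Hj; rewrite ler_pdivlMr ?mulr_gt0// ler_pdivrMl.
have b := bernoulli_le j (ltW h0).
rewrite exprM; apply: (@lt_le_trans _ _ ((1 + j%:R * h) ^+ 2)).
  rewrite !natrM.
  have : j%:R * (4 * D%:R) <= j%:R * (j%:R * h ^+ 2) by rewrite ler_wpM2l// ltW.
  nra.
have h0' := ltW h0; apply: lerXn2r => //; rewrite nnegrE.
  by rewrite addr_ge0// mulr_ge0.
by rewrite exprn_ge0// addr_ge0.
Qed.

Section Density.
Context {R : realType} {D : nat}.

Lemma freq0_weight_ge L : (0 < L)%N ->
  ((2 * L)%:R^-1) ^+ D <= @weight R D L (freq0_index D L).
Proof.
move=> L0; rewrite /weight; under eq_bigr => i _.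
  rewrite ffunE inordK; last by rewrite ltnS mul2n -addnn leq_addr.
  over.
rewrite prodr_const card_ord lerXn2r// ?nnegrE ?divr_ge0 ?exprn_ge0 ?invr_ge0//.
rewrite ler_pdivlMr ?exprn_gt0// ler_pdivrMl ?ltr0n ?muln_gt0//.
by rewrite -natrX -natrM ler_nat central_bin_lower.
Qed.

Lemma torus_norm_le (x : 'cV[R]_D) (eps : R) : `|x| <= eps ->
  torus_norm (torus_proj x) <= eps.
Proof.
move=> xe; apply: le_trans xe; apply: ge_inf; last by exists x.
by exists 0 => _ [y _ <-].
Qed.

(** If the representative of [x] with coordinates closest to zero is not
    small, one of its coordinates lies between [eps] and [1/2] in absolute
    value, where [cosp] is decreasing. *)
Lemma near_or_far (x : 'cV[R]_D) (eps : R) : 0 < eps -> eps < 2^-1 ->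
  torus_norm (torus_proj x) <= eps \/ exists i, cosp (x i 0) <= cosp eps.
Proof.
move=> e0 e2.
pose n i := Num.floor (x i 0 + 2^-1); pose r : 'cV[R]_D := \col_i (x i 0 - (n i)%:~R).
have -> : torus_proj x = torus_proj r.
  by apply/torus_proj_eqP => i; rewrite !mxE opprB addrC subrK intr_int.
have [re|re] := leP `|r| eps; first by left; exact: torus_norm_le.
right; have : mx_norm r != 0 by rewrite gt_eqF// (lt_trans e0).
move=> /mx_norm_neq0[[i j]] /= ri; exists i.
have {ri} ri : eps < `|r i 0| by move: re; rewrite [`|r|]ri ord1.
have -> : cosp (x i 0) = cosp `|r i 0|.
  have -> : cosp `|r i 0| = cosp (r i 0) by case: (ger0P (r i 0)) => _; rewrite ?cospN.
  have -> : x i 0 = r i 0 + (n i)%:~R by rewrite mxE subrK.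
  by rewrite cospDint ?intr_int.
have r2 : `|r i 0| <= 2^-1.
  rewrite mxE ler_norml; have := floor_itv (x i 0 + 2^-1); rewrite -/(n i) intrD.
  by move=> /andP[l u]; apply/andP; split; lra.
have p0 := pi_gt0 R.
rewrite /cosp ltW// ltr_cos ?ltr_pM2l ?mulr_gt0// in_itv /=; apply/andP; split.
- by rewrite mulr_ge0// ?mulr_ge0// ltW.
- by nra.
- by rewrite mulr_ge0// ?mulr_ge0// ltW.
- by nra.
Qed.

Lemma cosp_lt1 (eps : R) : 0 < eps -> eps < 2^-1 -> -1 < cosp eps < 1.
Proof.
move=> e0 e2; have p0 := pi_gt0 R.
rewrite -(@cospi R) -(@cos0 R) /cosp; apply/andP.
by split; rewrite ltr_cos ?in_itv /=; nra.
Qed.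

Lemma half_factor_itv (y : R) : 0 <= (1 + cosp y) / 2 <= 1.
Proof.
have := cos_le1 (2 * pi * y); have := cos_geN1 (2 * pi * y); rewrite -/(cosp y).
by move=> *; apply/andP; split; lra.
Qed.

Lemma cos_kernel_far L (x : 'cV[R]_D) c i : cosp (x i 0) <= c ->
  cos_kernel L x <= ((1 + c) / 2) ^+ L.
Proof.
move=> xc; rewrite /cos_kernel (bigD1 i)//= -[leRHS]mulr1.
have h j : 0 <= ((1 + cosp (x j 0)) / 2) ^+ L <= 1.
  have /andP[a b] := half_factor_itv (x j 0).
  by rewrite exprn_ge0//= exprn_ile1.
apply: ler_pM.
- by case/andP: (h i).
- by apply: prodr_ge0 => j _; case/andP: (h j).
- have /andP[a b] := half_factor_itv (x i 0).
  rewrite lerXn2r// ?nnegrE//; lra.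
- by apply: prodr_ile1 => j _; exact: h.
Qed.

(** The kernel is small away from the origin compared with its mean, the
    weight of the zero frequency. If all points stayed away from [a], the
    average of the kernel over the points, recentred at [a], would be too small
    for the remaining frequencies to make up the difference. *)
Lemma density_criterion (eps : R) : (0 < D)%N -> 0 < eps ->
  exists L, exists2 eta : R, 0 < eta & forall k (z : 'I_k -> 'cV[R]_D),
  (0 < k)%N ->
  (forall kappa : {ffun 'I_D -> 'I_(2 * L).+1}, freq kappa != 0 ->
    (\sum_i cosp (phase (freq kappa) (z i))) ^+ 2 +
    (\sum_i sinp (phase (freq kappa) (z i))) ^+ 2 <= (eta * k%:R) ^+ 2) ->
  forall a, exists i, torus_norm (torus_proj (a - z i)) <= eps.
Proof.
move=> D0 eps0.
pose e := Num.min eps 4^-1.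
have e0 : 0 < e by rewrite lt_min eps0 invr_gt0 ltr0n.
have e2 : e < 2^-1 by rewrite gt_min; apply/orP; right; lra.
have /andP[cl cu] := cosp_lt1 e0 e2.
pose rho := (1 + cosp e) / 2.
have r01 : 0 < rho < 1 by apply/andP; rewrite /rho; split; lra.
have [L L0 HL] := geometric_beats_power D0 r01.
pose W0 : R := @weight R D L (freq0_index D L).
have W0rho : rho ^+ L < W0 by apply: lt_le_trans HL _; exact: freq0_weight_ge.
exists L, ((W0 - rho ^+ L) / 2); first by rewrite divr_gt0// subr_gt0.
set eta := _ / 2; have eta0 : 0 <= eta by rewrite divr_ge0// subr_ge0 ltW.
move=> k z k0 small a; have kR : 0 < k%:R :> R by rewrite ltr0n.
apply: contrapT => /forallNP far.
have farT i : cos_kernel L (a - z i) <= rho ^+ L.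
  have [ne|[j]] := near_or_far (a - z i) e0 e2; last exact: cos_kernel_far.
  by case: (far i); apply: le_trans ne _; rewrite ge_min lexx.
have upper : \sum_i cos_kernel L (a - z i) <= k%:R * rho ^+ L.
  by rewrite mulr_natl -[k in leRHS]card_ord -sumr_const ler_sum.
have lower : k%:R * W0 - eta * k%:R <= \sum_i cos_kernel L (a - z i).
  under eq_bigr => i _ do rewrite cos_kernel_expansion.
  rewrite exchange_big /= (bigD1 (freq0_index D L))//= -/W0.
  rewrite -mulr_sumr (eq_bigr (fun=> 1)) => [|i _]; last first.
    by rewrite freq_freq0_index phase0l cosp_int ?int_num0.
  rewrite sumr_const card_ord -/W0 [W0 * _]mulrC lerD2l.
  apply: (@le_trans _ _ (\sum_(kappa | kappa != freq0_index D L)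
      @weight R D L kappa * - (eta * k%:R))).
    rewrite -mulr_suml mulrN lerN2 ler_piMl ?(mulr_ge0 eta0 (ltW kR))//.
    rewrite -[leRHS](@sum_weight R D L) [leRHS](bigD1 (freq0_index D L))//=.
    by rewrite lerDr weight_ge0.
  apply: ler_sum => kappa kn0; rewrite -mulr_sumr ler_wpM2l ?weight_ge0//.
  under eq_bigr => i _ do rewrite phaseBr cospB.
  rewrite big_split /= -!mulr_sumr.
  have f0 : freq kappa != 0 by apply: contraNneq kn0 => /freq_eq0 ->.
  have := small kappa f0; set C := \sum_i cosp _; set S := \sum_i sinp _ => CS.
  have p2 := cosp2Dsinp2 (phase (freq kappa) a).
  set c := cosp _ in p2 *; set s := sinp _ in p2 *.
  (* Cauchy-Schwarz, as Lagrange's identity. *)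
  have : (c * C + s * S) ^+ 2 <= (eta * k%:R) ^+ 2.
    apply: le_trans CS; rewrite -[leRHS]mul1r -p2 -subr_ge0.
    have -> : (c ^+ 2 + s ^+ 2) * (C ^+ 2 + S ^+ 2) - (c * C + s * S) ^+ 2 =
       (c * S - s * C) ^+ 2 by ring.
    exact: sqr_ge0.
  have v0 := mulr_ge0 eta0 (ltW kR).
  move=> sq; rewrite leNgt; apply/negP => lt.
  have lt' : eta * k%:R < - (c * C + s * S) by rewrite ltrNr.
  by have := ltr_pM v0 v0 lt' lt'; rewrite mulrNN -!expr2 ltNge sq.
have : 0 < k%:R * (W0 - rho ^+ L) by rewrite mulr_gt0// subr_gt0.
move: (le_trans lower upper); rewrite /eta; lra.
Qed.

End Density.

(** * Second moments and assembly *)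

(** Multiplication by [Q] followed by reduction modulo [Q] is injective on
    the [Q]-torsion of the torus, which therefore has at most [Q ^ d] points. *)
Lemma card_torsion_le (R : realType) (d k q : nat) (x : 'I_k -> 'cV[R]_d)
    (x0 : 'cV[R]_d) : injective (fun i => torus_proj (x i)) ->
  (#|[pred j | [forall r, ((x0 - x j) r 0 *+ q.+1 \is a Num.int)%R]]| <= q.+1 ^ d)%N.
Proof.
move=> xI; set P := [pred j | _].
pose a j r : int := Num.floor ((x0 - x j) r 0 *+ q.+1).
have aE j r : j \in P -> (a j r)%:~R = (x0 - x j) r 0 *+ q.+1 :> R.
  by move=> /forallP/(_ r)/floorK.
pose f j : {ffun 'I_d -> 'I_q.+1} := [ffun r => inord `|(a j r %% q.+1)%Z|%N].
have fI : {in P &, injective f}.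
  move=> j j' jP j'P ff; apply: xI; apply/torus_proj_eqP => r.
  have := congr1 (fun g : {ffun 'I_d -> 'I_q.+1} => (g r : nat)) ff.
  have lt b : (`|(b %% q.+1)%Z| < q.+1)%N.
    have := @ltz_mod b q.+1 isT; have := @modz_ge0 b q.+1 isT.
    by case: (b %% q.+1)%Z.
  rewrite !ffunE !inordK// => /(congr1 (fun n : nat => n%:Z)).
  rewrite !gez0_abs ?modz_ge0// => /eqP; rewrite eqz_mod_dvd => /dvdzP[c ac].
  have : (a j r - a j' r)%:~R = (c * q.+1)%:~R :> R by rewrite ac.
  rewrite intrB intrM !aE// => E.
  have -> : (x j - x j') r 0 = - c%:~R.
    apply: (@mulIf _ (q.+1%:R : R)); first by rewrite pnatr_eq0.
    move: E; rewrite -mulrnBl -[_ *+ q.+1]mulr_natr -pmulrn => E.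
    by rewrite mulNr -E !mxE; ring.
  by rewrite rpredN intr_int.
rewrite -(card_in_image fI) (leq_trans (max_card _))//.
by rewrite card_ffun !card_ord.
Qed.

(** Each of the at most [k * B] correlated pairs contributes at most [1], each
    of the others at most [delta]. *)
Lemma second_moment_le (R : realType) (T : Type) (E : (T -> R) -> R) (k B : nat)
    (phi : 'I_k -> T -> R) (delta : R) : is_mean E -> 0 <= delta ->
  (forall i, (#|[pred j | (delta < E (fun t => cosp (phi i t - phi j t)))%R]| <= B)%N) ->
  E (fun t => (\sum_i cosp (phi i t)) ^+ 2 + (\sum_i sinp (phi i t)) ^+ 2) <=
    k%:R * (B%:R + k%:R * delta).
Proof.
move=> mE d0 few.
under eq_fun do rewrite exp_sum_sq.
have cb i j : bounded_real (fun t => cosp (phi i t - phi j t)) by exact: bounded_cosp.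
rewrite (mean_sum mE); last by move=> i; exact: bounded_real_sum.
rewrite mulr_natl -[leRHS](_ : \sum_(i < k) (B%:R + k%:R * delta) = _); last first.
  by rewrite sumr_const card_ord.
apply: ler_sum => i _.
rewrite (mean_sum mE)//.
pose large j := delta < E (fun t => cosp (phi i t - phi j t)).
have le1 : \sum_j E (fun t => cosp (phi i t - phi j t)) <=
    \sum_j ((large j)%:R + delta).
  apply: ler_sum => j _; rewrite /large; case: ltP => [_|le]; last by rewrite add0r.
  apply: (@le_trans _ _ 1); last by rewrite lerDl.
  rewrite -[leRHS](mean_cst mE 1); apply: (mean_le mE) => //.
    exact: bounded_real_cst.
  by move=> t; exact: cos_le1.
apply: le_trans le1 _.
rewrite big_split /= sumr_const card_ord -[delta *+ _]mulr_natl lerD2r.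
by rewrite -natr_sum ler_nat -big_mkcond sum1_card; exact: few.
Qed.

Lemma word_prod_in (d : nat) (G : set 'M[int]_d) (w : seq 'M[int]_d) t :
  is_SLZ_subgroup G -> (forall u, u \in w -> G u) -> G (word_prod w t).
Proof.
move=> [_ G1 GM _]; elim: w t => [|u w IH] t Gw //=.
apply: (GM); last by apply: IH => v vw; apply: Gw; rewrite inE vw orbT.
elim: (head 0 t) => [|n IHn]; first by rewrite expr0.
by rewrite exprS; apply: (GM) => //; apply: Gw; rewrite mem_head.
Qed.

Section Assembly.
Context {R : realType} {M : (nat -> R) -> R} {d1 d2 : nat}.
Hypothesis mM : is_mean M.
Hypothesis shiftM : forall f, bounded_real f -> M (fun n => f n.+1) = M f.
Variables (s1 : seq 'M[int]_d1) (s2 : seq 'M[int]_d2).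

(** The first factor is averaged innermost, with the word in the second factor
    fixed. *)
Definition pair_mean (n : nat) (F : seq nat * seq nat -> R) : R :=
  word_mean M (word_power n s2) (fun t2 =>
    word_mean M (word_power n s1) (fun t1 => F (t1, t2))).

Lemma is_mean_pair n : is_mean (pair_mean n).
Proof.
exact: (@is_mean_bind _ _ _ _ _ _ (fun t2 t1 => (t1, t2))
  (is_mean_word mM _) (is_mean_word mM _)).
Qed.

Definition pair_phase (n : nat) (m1 : 'rV[int]_d1) (m2 : 'rV[int]_d2)
    (x : 'cV[R]_d1) (y : 'cV[R]_d2) (t : seq nat * seq nat) : R :=
  phase m1 (map_mx intr (word_prod (word_power n s1) t.1) *m x) +
  phase m2 (map_mx intr (word_prod (word_power n s2) t.2) *m y).

Variables (G1 : set 'M[int]_d1) (G2 : set 'M[int]_d2).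
Hypothesis (d1_ge2 : (2 <= d1)%N) (d2_ge2 : (2 <= d2)%N).
Hypothesis (G1S : is_SLZ_subgroup G1) (G2S : is_SLZ_subgroup G2).
Hypothesis (G1s : G1 = SLZ_generated [set` s1]).
Hypothesis (G2s : G2 = SLZ_generated [set` s2]).
Hypothesis (us1 : forall g, g \in s1 -> unipotent g).
Hypothesis (us2 : forall g, g \in s2 -> unipotent g).
Hypothesis (irr1 : irreducible_action R G1) (irr2 : irreducible_action R G2).

(** A nonzero character of the product is nontrivial on one of the factors;
    the other coordinate only contributes a phase, constant in the average over
    that factor. *)
Lemma pair_second_moment m1 m2 (delta : R) : m1 != 0 \/ m2 != 0 -> 0 < delta ->
  exists n0, forall n, (n0 <= n)%N -> exists B : nat,
  forall k (x : 'I_k -> 'cV[R]_d1) (y : 'I_k -> 'cV[R]_d2),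
  injective (fun i => torus_proj (x i)) ->
  injective (fun i => torus_proj (y i)) ->
  pair_mean n (fun t =>
    (\sum_i cosp (pair_phase n m1 m2 (x i) (y i) t)) ^+ 2 +
    (\sum_i sinp (pair_phase n m1 m2 (x i) (y i) t)) ^+ 2) <=
  k%:R * (B%:R + k%:R * delta).
Proof.
move=> m12 d0.
have phiB n x x' y y' t : pair_phase n m1 m2 x y t - pair_phase n m1 m2 x' y' t =
    pair_phase n m1 m2 (x - x') (y - y') t.
  by rewrite /pair_phase !mulmxBr !phaseBr; ring.
have [m10|m10] := eqVneq m1 0.
  have m20 : m2 != 0 by case: m12 => //; rewrite m10 eqxx.
  have [n0 Hn0] := character_decay mM shiftM d2_ge2 G2S G2s us2 irr2 m20 d0.
  exists n0 => n /Hn0[[//|q] _ Hq]; exists (q.+1 ^ d2)%N => k x y _ yI.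
  apply: second_moment_le; [exact: is_mean_pair|exact: ltW|move=> i].
  apply: leq_trans (card_torsion_le q (y i) yI); apply: subset_leq_card.
  apply/fintype.subsetP => j; rewrite !inE => lt; apply/forallP => r.
  apply: (Hq 0) => //; move: lt; rewrite /pair_mean.
  congr (_ < word_mean _ _ _); apply/funext => t2.
  rewrite -[RHS](mean_cst (is_mean_word mM (word_power n s1))).
  congr word_mean; apply/funext => t1.
  by rewrite phiB /pair_phase m10 phase0l phaseM.
have [n0 Hn0] := character_decay mM shiftM d1_ge2 G1S G1s us1 irr1 m10 d0.
exists n0 => n /Hn0[[//|q] _ Hq]; exists (q.+1 ^ d1)%N => k x y xI _.
apply: second_moment_le; [exact: is_mean_pair|exact: ltW|move=> i].
apply: leq_trans (card_torsion_le q (x i) xI); apply: subset_leq_card.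
apply/fintype.subsetP => j; rewrite !inE => lt; apply/forallP => r.
have [t2 Ht2] := mean_gt_ex (is_mean_word mM (word_power n s2))
  (@bounded_real_mean _ _ _ _ (fun t2 t1 => _) 1 (is_mean_word mM (word_power n s1))
    (fun t2 t1 => cosp_max _)) lt.
pose theta := phase m2 (map_mx intr (word_prod (word_power n s2) t2) *m (y i - y j)).
apply: (Hq theta); move: Ht2; congr (_ < word_mean _ _ _); apply/funext => t1.
by rewrite phiB /pair_phase phaseM addrC.
Qed.

End Assembly.

Lemma phase_col_mx (R : realType) (d1 d2 : nat) (m : 'rV[int]_(d1 + d2))
    (x : 'cV[R]_d1) (y : 'cV[R]_d2) :
  phase m (col_mx x y) = phase (lsubmx m) x + phase (rsubmx m) y.
Proof. by rewrite /phase -{1}[m]hsubmxK map_row_mx mul_row_col mxE. Qed.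

Lemma card_le_ord_inj (T : Type) (k : nat) (Y : set T) : `I_k #<= Y ->
  exists y : 'I_k -> T, (forall i, Y (y i)) /\ injective y.
Proof.
move=> /card_leP[f].
have mI (i : 'I_k) : (i : nat) \in `I_k by apply/mem_set; exact: ltn_ord.
pose F i := f (SigSub (mI i)).
exists (fun i => set_val (F i)); split=> [i|i j].
  by apply: set_mem; exact: valP.
move=> /val_inj /(inj (mem_set I)) => /(_ (mem_set I)) /(congr1 val) /=.
by move=> /= ij; apply: val_inj.
Qed.

Theorem theoremB (R : realType) (d1 d2 : nat)
    (G1 : set 'M[int]_d1) (G2 : set 'M[int]_d2) :
  (2 <= d1)%N -> (2 <= d2)%N ->
  is_SLZ_subgroup G1 -> is_SLZ_subgroup G2 ->
  unipotently_generated G1 -> unipotently_generated G2 ->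
  irreducible_action R G1 -> irreducible_action R G2 ->
  forall eps : R, 0 < eps ->
  exists k : nat, forall Y : set (torus R d1 * torus R d2),
    `I_k #<= Y -> set_inj Y fst -> set_inj Y snd ->
    exists g : 'M[int]_d1 * 'M[int]_d2,
      [/\ G1 g.1, G2 g.2
        & eps_dense eps (@torus_join R d1 d2 @` (prod_act g @` Y))].
Proof.
move=> d1_ge2 d2_ge2 G1S G2S [s1 us1 G1s] [s2 us2 G2s] irr1 irr2 eps eps0.
have [M [mM shiftM]] := banach_mean_exists R.
have D0 : (0 < d1 + d2)%N by rewrite addn_gt0 (leq_trans _ d1_ge2).
have [L [eta eta0 dense]] := @density_criterion R (d1 + d2) eps D0 eps0.
pose K := {ffun 'I_(d1 + d2) -> 'I_(2 * L).+1}.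
pose N := #|{: K}|.
(* [N.+1] rather than [N]: all the [delta]-contributions add up to at most
   half of [(eta * k) ^+ 2], and the denominator is visibly nonzero. *)
pose delta := eta ^+ 2 / (2 * N.+1%:R).
have N0 : 0 < N.+1%:R :> R by rewrite ltr0n.
have delta0 : 0 < delta by rewrite divr_gt0 ?exprn_gt0 ?mulr_gt0.
pose m1 (kappa : K) := lsubmx (freq kappa).
pose m2 (kappa : K) := rsubmx (freq kappa).
have m12 kappa : freq kappa != 0 -> m1 kappa != 0 \/ m2 kappa != 0.
  move=> f0; have [m10|] := eqVneq (m1 kappa) 0; last by left.
  right; apply: contra_neq f0 => m20.
  by rewrite -[freq kappa]hsubmxK -/(m1 kappa) -/(m2 kappa) m10 m20 row_mx0.
pose S n k (x : 'I_k -> 'cV[R]_d1) (y : 'I_k -> 'cV[R]_d2) kappa t :=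
  (\sum_i cosp (pair_phase s1 s2 n (m1 kappa) (m2 kappa) (x i) (y i) t)) ^+ 2 +
  (\sum_i sinp (pair_phase s1 s2 n (m1 kappa) (m2 kappa) (x i) (y i) t)) ^+ 2.
pose moment_bound kappa n (B : nat) := forall k x y,
  injective (fun i => torus_proj (x i)) -> injective (fun i => torus_proj (y i)) ->
  @pair_mean R M d1 d2 s1 s2 n (S n k x y kappa) <= k%:R * (B%:R + k%:R * delta).
have /choice[n0 Hn0] : forall kappa : K, exists n0 : nat, freq kappa != 0 ->
    forall n, (n0 <= n)%N -> exists B, moment_bound kappa n B.
  move=> kappa; have [f0|f0] := eqVneq (freq kappa) 0; first by exists 0%N.
  have [n0 Hn0] := pair_second_moment mM shiftM d1_ge2 d2_ge2 G1S G2S G1s G2s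
    us1 us2 irr1 irr2 (m12 kappa f0) delta0.
  by exists n0 => _.
pose n := \max_kappa n0 kappa.
have /choice[B HB] : forall kappa : K, exists B : nat, freq kappa != 0 ->
    moment_bound kappa n B.
  move=> kappa; have [f0|f0] := eqVneq (freq kappa) 0; first by exists 0%N.
  by have [B HB] := Hn0 kappa f0 n (leq_bigmax kappa); exists B.
(* [k] is chosen so that [k * Bs], the contribution of the exceptional pairs
   for all characters together, is less than half of [(eta * k) ^+ 2]. *)
pose Bs := (\sum_kappa B kappa)%N.
pose k := (Num.truncn (2 * Bs%:R / eta ^+ 2)).+1.
have kR : 0 < k%:R :> R by rewrite ltr0n.
have kB : 2 * Bs%:R < k%:R * eta ^+ 2.
  by rewrite -ltr_pdivrMr ?exprn_gt0// /k truncnS_gt.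
exists k => Y /card_le_ord_inj[y [yY yI]] Y1 Y2.
pose x1 i := torus_repr (y i).1; pose x2 i := torus_repr (y i).2.
have x1I : injective (fun i => torus_proj (x1 i)).
  by move=> i j; rewrite !torus_projK => E; apply: yI; apply: Y1 => //; exact/mem_set.
have x2I : injective (fun i => torus_proj (x2 i)).
  by move=> i j; rewrite !torus_projK => E; apply: yI; apply: Y2 => //; exact/mem_set.
have Sb kappa : bounded_real (S n k x1 x2 kappa).
  apply: bounded_realD; apply: bounded_realM; apply: bounded_real_sum => i;
  solve [exact: bounded_cosp|exact: bounded_sinp].
have mE := is_mean_pair mM s1 s2 n.
have [t Ht] : exists t, \sum_(kappa | freq kappa != 0) S n k x1 x2 kappa t < (eta * k%:R) ^+ 2.
  apply: (mean_lt_ex mE); first exact: bounded_real_sum.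
  rewrite (mean_sum mE)//.
  apply: (@le_lt_trans _ _ (\sum_(kappa : K) k%:R * ((B kappa)%:R + k%:R * delta))).
    rewrite big_mkcond /=; apply: ler_sum => kappa _.
    case: ifPn => [f0|_]; first exact: HB.
    by rewrite mulr_ge0// ?addr_ge0// ?mulr_ge0// ltW.
  rewrite -mulr_sumr big_split /= sumr_const -/N -natr_sum -/Bs.
  rewrite -[_ *+ N]mulr_natl exprMn [eta ^+ 2 * _]mulrC expr2 -mulrA ltr_pM2l//.
  have -> : k%:R * eta ^+ 2 = k%:R * eta ^+ 2 / 2 + N.+1%:R * (k%:R * delta).
    by rewrite /delta; field; rewrite gt_eqF// andbT pnatr_eq0.
  rewrite ltr_leD//; first by lra.
  by rewrite ler_wpM2r ?ler_nat// mulr_ge0// ltW.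
have sG1 : [set` s1] `<=` G1 by rewrite G1s; exact: sub_smallest.
have sG2 : [set` s2] `<=` G2 by rewrite G2s; exact: sub_smallest.
pose g1 := word_prod (word_power n s1) t.1; pose g2 := word_prod (word_power n s2) t.2.
exists (g1, g2); split=> /=.
- by apply: word_prod_in => // u /word_power_mem; exact: sG1.
- by apply: word_prod_in => // u /word_power_mem; exact: sG2.
move=> a; pose z i := col_mx (map_mx intr g1 *m x1 i) (map_mx intr g2 *m x2 i).
have [//|kappa f0|i Hi] := dense k z _ _ (torus_repr a).
  rewrite (le_trans _ (ltW Ht))// (bigD1 kappa)//= /S.
  rewrite [X in _ <= X + _](_ : _ = (\sum_i cosp (phase (freq kappa) (z i))) ^+ 2 +
    (\sum_i sinp (phase (freq kappa) (z i))) ^+ 2); last first.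
    by congr (_ ^+ 2 + _ ^+ 2); apply: eq_bigr => i _; rewrite phase_col_mx.
  by rewrite lerDl; apply: sumr_ge0 => kappa' _; rewrite addr_ge0// sqr_ge0.
exists (torus_proj (z i)).
  exists (prod_act (g1, g2) (y i)); first by exists (y i).
  by rewrite /prod_act /torus_act torus_joinE.
by rewrite -(torus_projK a) -torus_projB.
Qed.
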